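(* Let $A\in\mathbb{R}^{n\times n}$ be symmetric positive semidefinite with $A\neq 0$, let $B\in\mathbb{R}^{n\times n}$ be symmetric positive definite, and let $f(x)=x^TBx-(x^TAx)^{1/2}$ for $x\in\mathbb{R}^n$. Let $L_+>0$ be a positive Lipschitz constant of $f$, i.e. $\nabla^2 f(x)\preceq L_+ I$ for all $x$ with $Ax\neq 0$. Suppose the gradient descent method $x_{k+1}=x_k-\alpha\nabla f(x_k)$, $k\ge 0$, is started at a random point $x_0\in\mathbb{R}^n$ and uses a fixed stepsize $\alpha\equiv\alpha_0$, where $\alpha_0$ is sampled uniformly from the interval $(0,2/L_+)$. Then with probability one (precisely: for Lebesgue-almost every pair $(x_0,\alpha_0)\in\mathbb{R}^n\times(0,2/L_+)$) the generated sequence $\{x_k\}$ converges to a global minimizer of $f$ over $\mathbb{R}^n$.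
   Context: The function $f$ is differentiable on $\Theta=\{x: Ax\neq 0\}$, where its gradient and Hessian are $$\nabla f(x)=2Bx-\frac{Ax}{(x^TAx)^{1/2}},\qquad \nabla^2 f(x)=2B-\frac{A}{(x^TAx)^{1/2}}+\frac{(Ax)(Ax)^T}{(x^TAx)^{3/2}}.$$ The gradient descent iteration is defined as long as the iterates lie in $\Theta$; the assertion that the generated sequence converges includes that the iteration is well defined for all $k$. $M\preceq N$ means $N-M$ is positive semidefinite. *)

(* Defs.v *)
From HB Require Import structures.
From mathcomp Require Import all_boot all_order all_algebra.
From mathcomp Require Import all_classical all_reals all_analysis.

Set Implicit Arguments.
Unset Strict Implicit.
Unset Printing Implicit Defensive.

Import Order.TTheory GRing.Theory Num.Theory.
Import numFieldNormedType.Exports.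

Local Open Scope classical_set_scope.
Local Open Scope ring_scope.

Section matrix_order.
Variables (R : numDomainType) (n : nat).
Implicit Types M N : 'M[R]_n.

Definition quad_form M (x : 'cV[R]_n) : R := (x^T *m M *m x) 0 0.

Definition psdmx M := M^T = M /\ forall x, 0 <= quad_form M x.

Definition pdmx M := M^T = M /\ forall x, x != 0 -> 0 < quad_form M x.

Definition loewner_le M N := psdmx (N - M).

End matrix_order.

Section differential_operators.
Variables (R : numFieldType) (n : nat).
Implicit Types f : 'cV[R]_n -> R.

(* The library's limit is total: these are the true gradient and Hessian only
   at points where the derivatives involved exist. *)
Definition gradient f (x : 'cV[R]_n) : 'cV[R]_n :=
  \col_i 'D_(delta_mx i 0) f x.

Definition hessian f (x : 'cV[R]_n) : 'M[R]_n :=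
  \matrix_(i, j) 'D_(delta_mx i 0) (fun y => gradient f y j 0) x.

Definition gradient_descent f (alpha : R) (x0 : 'cV[R]_n) (k : nat) : 'cV[R]_n :=
  iter k (fun x => x - alpha *: gradient f x) x0.

End differential_operators.

Definition objective (R : rcfType) n (A B : 'M[R]_n) (x : 'cV[R]_n) : R :=
  quad_form B x - Num.sqrt (quad_form A x).

Section lebesgue_tuple_step.
Context (R : realType) (n : nat).
Variable m : {sigma_finite_measure set (n.-tuple (measurableTypeR R)) -> \bar R}.

Definition tuple_cons (z : measurableTypeR R * n.-tuple (measurableTypeR R)) :
  n.+1.-tuple (measurableTypeR R) := [tuple of z.1 :: z.2].

Lemma measurable_tuple_cons : measurable_fun setT tuple_cons.
Proof. exact: (measurable_cons measurable_fst measurable_snd). Qed.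

Definition lebesgue_step : set (n.+1.-tuple (measurableTypeR R)) -> \bar R :=
  pushforward (lebesgue_measure \x m)%E tuple_cons.

Let lebesgue_step0 : lebesgue_step set0 = 0%E.
Proof. by rewrite /lebesgue_step /pushforward preimage_set0 measure0. Qed.

Let lebesgue_step_ge0 X : (0 <= lebesgue_step X)%E.
Proof. by rewrite /lebesgue_step /pushforward measure_ge0. Qed.

Let lebesgue_step_sigma_additive : semi_sigma_additive lebesgue_step.
Proof.
move=> F mF tF mUF; rewrite /lebesgue_step /pushforward preimage_bigcup.
have mcons X : measurable X -> measurable (tuple_cons @^-1` X).
  by move=> mX; rewrite -[X in measurable X]setTI; exact: measurable_tuple_cons.
apply: measure_semi_sigma_additive.
- by move=> i; exact: mcons.
- apply/trivIsetP => /= i j _ _ ij; rewrite -preimage_setI.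
  by move/trivIsetP : tF => /(_ _ _ _ _ ij) ->//; rewrite preimage_set0.
- by rewrite -preimage_bigcup; exact: mcons.
Qed.

HB.instance Definition _ := isMeasure.Build _ _ _ lebesgue_step
  lebesgue_step0 lebesgue_step_ge0 lebesgue_step_sigma_additive.

Let lebesgue_step_sigma_finite : sigma_finite setT lebesgue_step.
Proof.
have /sigma_finiteP[F [TF ndF Foo]] := sigma_finiteT (@lebesgue_measure R).
have /sigma_finiteP[G [TG ndG Goo]] := sigma_finiteT m.
pose g (t : n.+1.-tuple (measurableTypeR R)) :
  measurableTypeR R * n.-tuple (measurableTypeR R) :=
  (tnth t ord0, [tuple of behead t]).
have mg : measurable_fun setT g.
  apply/measurable_fun_pairP; split; first exact: measurable_tnth.
  exact: measurable_behead.
have gK z : g (tuple_cons z) = z.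
  by case: z => a s; rewrite /g; congr pair; apply: val_inj.
exists (fun k => g @^-1` (F k `*` G k)).
  rewrite -preimage_bigcup (_ : \bigcup_k _ = setT) ?preimage_setT//.
  apply/seteqP; split => // -[a s] _.
  have [i _ Fa] : (\bigcup_i F i) a by rewrite -TF.
  have [j _ Gs] : (\bigcup_i G i) s by rewrite -TG.
  exists (maxn i j) => //; split => /=.
    by move: a Fa; exact/subsetPset/ndF/leq_maxl.
  by move: s Gs; exact/subsetPset/ndG/leq_maxr.
move=> k; have [? ?] := Foo k; have [? ?] := Goo k.
have mFG : measurable (F k `*` G k) by exact: measurableX.
split; first by rewrite -[X in measurable X]setTI; exact: mg.
rewrite /lebesgue_step /pushforward (_ : _ @^-1` _ = F k `*` G k); last first.
  by rewrite -comp_preimage (_ : g \o tuple_cons = id)//; exact/funext.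
by rewrite product_measure1E// lte_mul_pinfty// ge0_fin_numE.
Qed.

HB.instance Definition _ := Measure_isSigmaFinite.Build _ _ _ lebesgue_step
  lebesgue_step_sigma_finite.

End lebesgue_tuple_step.

(* Lebesgue measure on R^n, as the n-fold product of Lebesgue measure on R;
   the library's measurable structure on R^n lives on tuples. *)
Fixpoint lebesgue_tuple (R : realType) (n : nat) :
    {sigma_finite_measure set (n.-tuple (measurableTypeR R)) -> \bar R} :=
  match n with
  | 0 => \d_([tuple] : 0.-tuple (measurableTypeR R))
  | n'.+1 => lebesgue_step (lebesgue_tuple R n')
  end.

Lemma lebesgue_tuple_box (R : realType) (n : nat)
    (X : 'I_n -> set (measurableTypeR R)) : (forall i, measurable (X i)) ->
  lebesgue_tuple R n [set t | forall i, X i (tnth t i)] =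
  (\prod_(i < n) lebesgue_measure (X i))%E.
Proof.
elim: n X => [|n IHn] X mX.
  rewrite big_ord0 /= diracE mem_set//= => -[].
  by [].
rewrite big_ord_recl -IHn// -product_measure1E//=; last first.
  rewrite [X in measurable X](_ : _ = \bigcap_(i in [set: 'I_n])
      ((@tnth n (measurableTypeR R))^~ i @^-1` X (lift ord0 i))); last first.
    by apply/seteqP; split => t /= tX i; [move=> _|]; apply: tX.
  apply: fin_bigcap_measurable => // i _; rewrite -[X in measurable X]setTI.
  exact: measurable_tnth.
rewrite /lebesgue_step /pushforward /=; congr product_measure1.
apply/seteqP; split => -[a s] /=.
  move=> aX; split; first exact: (aX ord0).
  by move=> i; have := aX (lift ord0 i); rewrite tnthS.
move=> [aX sX] i; case: (unliftP ord0 i) => [j ->|->//].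
by rewrite tnthS; exact: sX.
Qed.

Definition col_of_tuple (R : Type) n (t : n.-tuple R) : 'cV[R]_n :=
  \col_i tnth t i.

(* Main.v *)
(** The gradient step is [T_a x = x - a g x] with [g x = 2 B x - psi x],
    [psi x = A x / s x] and [s x = sqrt (x' A x)].  There is an exact identity
    [psi x - psi y = M(x, y) (x - y)] with [M] explicit and locally Lipschitz,
    which replaces all differential calculus; since [hess (t x)] tends to [2 B]
    as [t] grows, the Hessian bound forces [2 B <= L].

    Convergence: [-s] is concave, so each step decreases [f] by a multiple of
    [|g|^2].  Hence [g (x_k) -> 0], and [s (x_k) = x_k' g (x_k) - 2 f (x_k)]
    converges to some [sb > 0].  With [H = 2 B - A / sb] one has
    [f - f* = x' H x / 2 + (s - sb)^2 / (2 sb)], which yields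
    [f - f* <= C |g|^2] along the tail, hence geometric decrease and convergence
    to a critical point.  There, if [H >= 0] the same identity shows that the
    point is a global minimizer; otherwise it is a strict saddle.

    Null sets are the sets coverable by cubes of arbitrarily small total volume.
    They pull back along maps expanding distances by a constant factor, and
    Lipschitz graphs over hyperplanes are null.  In (point, stepsize) space three
    sets are null: the kernel of [A]; the set where [1 - a hess x] is singular, on
    which [1 / a] is locally a Lipschitz function of [x]; and the set of points
    staying near a saddle forever, on which an indefinite quadratic form expanded
    by the dynamics is nonpositive.  Off the second set the gradient map is
    locally bi-Lipschitz, so the preimages of these sets under all iterates are
    null as well. *)

Require Import Defs.
From mathcomp Require Import all_boot all_order all_algebra.
From mathcomp Require Import all_classical all_reals all_analysis.
From mathcomp Require Import lra ring.

Set Implicit Arguments.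
Unset Strict Implicit.
Unset Printing Implicit Defensive.

Import Order.TTheory GRing.Theory Num.Theory.
Import numFieldNormedType.Exports.

Local Open Scope classical_set_scope.
Local Open Scope ring_scope.

(** * Null sets *)

Section max_norm.
Variable R : realType.

Lemma mx_norm_leP m n (x : 'M[R]_(m, n)) (M : R) :
  0 <= M -> `|x| <= M <-> forall i j, `|x i j| <= M.
Proof.
move=> M0; rewrite [`|x|]/Num.norm /= mx_normrE; split.
  by move=> /bigmax_leP[_ h] i j; exact: (h (i, j) erefl).
by move=> h; apply/bigmax_leP; split => // -[i j] _; exact: h.
Qed.

Lemma ler_mx_norm_entry m n (x : 'M[R]_(m, n)) i j : `|x i j| <= `|x|.
Proof. by have /(_ (lexx _)) := (mx_norm_leP x (normr_ge0 x)).1; apply. Qed.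

Lemma pair_norm_leP (V : normedModType R) (w : V * R) (M : R) :
  `|w| <= M <-> `|w.1| <= M /\ `|w.2| <= M.
Proof.
rewrite prod_normE ge_max.
by split => [/andP[]|[-> ->]].
Qed.

End max_norm.

(** * Null sets of R^(n+1) through countable cube covers *)

Section cube_null.
Variables (R : realType) (n : nat).
Local Notation V := ('cV[R]_n * R)%type.
Implicit Types (S : set V) (e : R).

(* Norms are sup norms, so [|w - c| <= r] is a cube of R^(n+1). *)
Definition cube_null S := forall e, 0 < e -> exists (c : nat -> V) (r : nat -> R),
  [/\ forall i, 0 <= r i,
      forall w, S w -> exists i, `|w - c i| <= r i &
      forall N, \sum_(i < N) r i ^+ n.+1 <= e].

(** Numbers that encode no element of [I] receive a cube of radius 0, which adds no volume because
    the exponent [n.+1] is positive. *)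
Lemma cube_cover_count (I : countType) S e :
  (exists (c : I -> V) (r : I -> R),
    [/\ forall i, 0 <= r i,
      forall w, S w -> exists i, `|w - c i| <= r i &
      forall s : seq I, uniq s -> \sum_(i <- s) r i ^+ n.+1 <= e]) ->
  exists (c : nat -> V) (r : nat -> R),
    [/\ forall i, 0 <= r i,
      forall w, S w -> exists i, `|w - c i| <= r i &
      forall N, \sum_(i < N) r i ^+ n.+1 <= e].
Proof.
move=> [c [r [r0 cov sum]]].
exists (fun m => if pickle_inv m is Some i then c i else 0).
exists (fun m => if pickle_inv m is Some i then r i else 0).
split => [m|w /cov[i wi]|N]; first by case: pickle_inv.
  by exists (pickle i); rewrite pickleK_inv.
rewrite -(big_mkord xpredT
  (fun m => (if pickle_inv m is Some i then r i else 0) ^+ n.+1)).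
have -> : \sum_(0 <= m < N) (if pickle_inv m is Some i then r i else 0) ^+ n.+1
    = \sum_(i <- pmap (@pickle_inv I) (index_iota 0 N)) r i ^+ n.+1.
  elim: (index_iota 0 N) => [|m s IH]; first by rewrite !big_nil.
  rewrite big_cons /= IH; case: (pickle_inv m) => [i|] /=.
    by rewrite big_cons.
  by rewrite expr0n add0r.
by apply/sum/(pmap_uniq (@pickle_invK I))/iota_uniq.
Qed.

Lemma cube_null_sub S S' : S `<=` S' -> cube_null S' -> cube_null S.
Proof.
move=> sub h e /h[c [r [r0 cov sum]]]; exists c, r; split => // w /sub.
exact: cov.
Qed.

Lemma cube_null_set0 : cube_null set0.
Proof.
move=> e e0; exists (fun=> 0), (fun=> 0); split => // N.
by rewrite big1 ?ltW// => i _; rewrite expr0n.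
Qed.

Lemma ler_sum_sub_uniq (I : eqType) (s t : seq I) (F : I -> R) :
  uniq s -> uniq t -> {subset s <= t} -> (forall i, 0 <= F i) ->
  \sum_(i <- s) F i <= \sum_(i <- t) F i.
Proof.
move=> us ut st F0; rewrite [leRHS](bigID (mem s)) /=.
rewrite -[X in _ <= X + _]big_filter
  [X in _ <= X + _](perm_big s); last first.
  apply: uniq_perm; rewrite ?filter_uniq//.
  by move=> i; rewrite mem_filter andb_idr//; exact: st.
by rewrite lerDl sumr_ge0.
Qed.

Lemma sum_half_le (e : R) N : 0 <= e -> \sum_(i < N) e / 2 ^+ i.+1 <= e.
Proof.
move=> e0; suff -> : \sum_(i < N) e / 2 ^+ i.+1 = e - e / 2 ^+ N.
  by rewrite gerBl divr_ge0// exprn_ge0.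
elim: N => [|N IH]; first by rewrite big_ord0 expr0 divr1 subrr.
rewrite big_ord_recr /= IH exprS; field.
by rewrite expf_neq0.
Qed.

(** The i-th set is covered with volume budget [e / 2 ^+ i.+1]. Finitely many index pairs always fit
    in a square, over which the budgets sum to at most [e]. *)
Lemma cube_null_bigcup (F : nat -> set V) :
  (forall i, cube_null (F i)) -> cube_null (\bigcup_i F i).
Proof.
move=> h; move=> e e0; apply: (@cube_cover_count (nat * nat)%type).
have /choice[c /choice[r cr]] : forall i, exists c : nat -> V,
    exists r : nat -> R, [/\ forall j, 0 <= r j,
    forall w, F i w -> exists j, `|w - c j| <= r j &
    forall N, \sum_(j < N) r j ^+ n.+1 <= e / 2 ^+ i.+1].
  by move=> i; apply: h; rewrite divr_gt0// exprn_gt0.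
exists (fun p => c p.1 p.2), (fun p => r p.1 p.2); split => [p|w [i _]|s us].
- by have [r0 _ _] := cr p.1; exact: r0.
- by have [_ cov _] := cr i => /cov[j wj]; exists (i, j).
pose N := (\max_(p <- s) maxn p.1 p.2).+1.
pose t := [seq (i, j) | i <- iota 0 N, j <- iota 0 N].
apply: (@le_trans _ _ (\sum_(p <- t) r p.1 p.2 ^+ n.+1)).
  apply: ler_sum_sub_uniq.
  - exact: us.
  - by apply: allpairs_uniq; rewrite ?iota_uniq// => -[? ?] [? ?] _ _ [-> ->].
  - move=> [i j] ps; apply/allpairsP; exists (i, j).
    have := @leq_bigmax_seq _ s xpredT (fun p => maxn p.1 p.2) _ ps erefl.
    rewrite geq_max => /andP[iN jN].
    by split; rewrite ?mem_iota ?add0n ?ltnS.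
  - by move=> p; have [r0 _ _] := cr p.1; rewrite exprn_ge0.
rewrite big_allpairs /=.
apply: (@le_trans _ _ (\sum_(i < N) e / 2 ^+ i.+1)); last exact/sum_half_le/ltW.
rewrite -(big_mkord xpredT (fun i => e / 2 ^+ i.+1)) /index_iota subn0.
apply: ler_sum => i _; have [_ _] := cr i => /(_ N).
by rewrite -(big_mkord xpredT (fun j => r i j ^+ n.+1)) /index_iota subn0.
Qed.

Lemma cube_null_bigcup_count (I : countType) (F : I -> set V) :
  (forall i, cube_null (F i)) -> cube_null (\bigcup_i F i).
Proof.
move=> h; apply: (@cube_null_sub _ (\bigcup_k
    (if unpickle k is Some i then F i else set0))).
  by move=> w [i _ wi]; exists (pickle i) => //; rewrite pickleK.
apply: cube_null_bigcup => k; case: unpickle => // ; exact: cube_null_set0.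
Qed.

Lemma cube_nullU S S' : cube_null S -> cube_null S' -> cube_null (S `|` S').
Proof.
move=> h h'; apply: (@cube_null_sub _ (\bigcup_(b : bool) if b then S else S')).
  by move=> w [?|?]; [exists true | exists false].
by apply: cube_null_bigcup_count => -[].
Qed.

(** A cube of radius r meeting the image is recentred at some [F a] with [a] in [S], at the price of
    doubling r. Its preimage in [S] then lies in the cube of radius 2 C r around [a], so volumes
    grow by the factor [D] at most. *)
Lemma cube_null_pullback (C : R) S (F : V -> V) :
  (forall w w', S w -> S w' -> `|w - w'| <= C * `|F w - F w'|) ->
  cube_null (F @` S) -> cube_null S.
Proof.
move=> lip h; wlog C0 : C lip / 0 < C.
  move=> H; apply: (H (`|C| + 1)).
    move=> w w' Sw Sw'; apply: (le_trans (lip _ _ Sw Sw')).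
    by rewrite ler_wpM2r// ler_wpDr// ler_norm.
  by rewrite ltr_wpDl.
have [->|/set0P[w0 Sw0]] := eqVneq S set0; first exact: cube_null_set0.
move=> e e0; pose D := (2 * C) ^+ n.+1.
have D0 : 0 < D by rewrite exprn_gt0// mulr_gt0.
have [c [r [r0 cov sum]]] := h (e / D) (divr_gt0 e0 D0).
have /choice[a ha] : forall i, exists a,
    forall w, S w -> `|F w - c i| <= r i -> S a /\ `|F a - c i| <= r i.
  move=> i; have [[a [Sa ai]]|no] := pselect (exists a, S a /\ `|F a - c i| <= r i).
    by exists a.
  by exists w0 => w Sw wi; exfalso; apply: no; exists w.
exists a, (fun i => 2 * C * r i); split.
- by move=> i; rewrite mulr_ge0// mulr_ge0// ltW.
- move=> w Sw; have [|i wi] := cov (F w); first by exists w.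
  exists i; have [Sa ai] := ha _ _ Sw wi.
  apply: (le_trans (lip _ _ Sw Sa)); rewrite -mulrA mulrCA ler_pM2l//.
  rewrite mulr2n mulrDl !mul1r -[F w - F (a i)](subrKA (c i)).
  by apply: (le_trans (ler_normD _ _)); rewrite lerD// distrC.
- move=> N; under eq_bigr do rewrite exprMn.
  by rewrite -mulr_sumr mulrC -ler_pdivlMr.
Qed.

Lemma cube_null_hyperplane : cube_null [set w | w.2 = 0].
Proof.
apply: (@cube_null_sub _ (\bigcup_m [set w | w.2 = 0 /\ `|w.1| <= m.+1%:R])).
  move=> w w0; exists (Num.truncn `|w.1|) => //; split => //.
  by rewrite ltW// truncnS_gt.
apply: cube_null_bigcup => m.
set M : R := m.+1%:R; have M0 : 0 < M by rewrite ltr0n.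
(* A grid of mesh 2 M / N uses (N + 1)^n <= (2 N)^n cubes, of total volume at most K e / N; this is
   at most [e] since N > K. *)
move=> e e0; pose K := 2 ^+ n * (2 * M) ^+ n.+1 / e.
pose N := (Num.truncn K).+1.
have N0 : 0 < N%:R :> R by rewrite ltr0n.
pose h := 2 * M / N%:R; have h0 : 0 < h by rewrite divr_gt0 ?mulr_gt0.
apply: (@cube_cover_count {ffun 'I_n -> 'I_N.+1}).
exists (fun k : {ffun 'I_n -> 'I_N.+1} => (\col_i ((k i : nat)%:R * h - M), 0)), (fun=> h); split.
- by move=> _; exact: ltW.
- move=> [x a] /= [-> xM].
  have xi i : 0 <= x i 0 + M <= 2 * M.
    have := le_trans (ler_mx_norm_entry x i 0) xM.
    by rewrite ler_norml => /andP[? ?]; lra.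
  exists [ffun i => inord (Num.truncn ((x i 0 + M) / h))].
  apply/pair_norm_leP; split => /=; last by rewrite subr0 normr0 ltW.
  apply/mx_norm_leP; first exact: ltW.
  move=> i j; rewrite !mxE ord1 ffunE.
  have /andP[y0 y1] := xi i.
  have yN : 0 <= (x i 0 + M) / h <= N%:R.
    rewrite divr_ge0 ?(ltW h0)//= ler_pdivrMr//.
    by rewrite /h mulrCA divff ?mulr1// gt_eqF.
  rewrite inordK; last first.
    rewrite ltnS -(ler_nat R); case/andP: yN => y2 y3.
    by apply: le_trans y3; rewrite truncn_le.
  have /andP[] := truncn_itv (proj1 (andP yN)).
  rewrite ler_pdivlMr// ltr_pdivrMr// => z1 z2.
  rewrite ler_norml; apply/andP; move: z2; rewrite -natr1 mulrDl mul1r => z2.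
  by split; lra.
- move=> s us; apply: (@le_trans _ _ (\sum_(k : {ffun 'I_n -> 'I_N.+1}) h ^+ n.+1)).
    apply: ler_sum_sub_uniq;
      [exact: us|exact: index_enum_uniq|by move=> i _; rewrite mem_index_enum|].
    by move=> i; rewrite exprn_ge0// ltW.
  rewrite sumr_const card_ffun !card_ord -mulr_natl natrX.
  apply: (@le_trans _ _ ((2 * N%:R) ^+ n * h ^+ n.+1)).
    rewrite ler_wpM2r ?exprn_ge0 ?(ltW h0)// lerXn2r ?nnegrE ?mulr_ge0//.
    by rewrite -natrM ler_nat mul2n -addnn -addn1 leq_add.
  rewrite /h exprMn expr_div_n.
  have -> : 2 ^+ n * N%:R ^+ n * ((2 * M) ^+ n.+1 / N%:R ^+ n.+1) =
      K * e / N%:R.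
    rewrite /K (exprS N%:R); field.
    by rewrite expf_neq0 ?gt_eqF.
  rewrite ler_pdivrMr// mulrC ler_pM2l//.
  by rewrite ltW// truncnS_gt.
Qed.

End cube_null.

(** * Localization by rational cubes, and Lipschitz graphs *)

Section rational_cubes.
Variables (R : realType) (n : nat).
Local Notation V := ('cV[R]_n * R)%type.
Implicit Types (S : set V) (w : V).

Definition rat_center (q : 'cV[rat]_n * rat * nat) : V :=
  (map_mx ratr q.1.1, ratr q.1.2).

Definition rat_cube q : set V :=
  [set w | `|w - rat_center q| <= q.2.+1%:R^-1].

(* The factor 1/2 puts [w] in the interior of the cube. *)
Lemma rat_cube_dense w r : 0 < r -> exists q,
  `|w - rat_center q| <= q.2.+1%:R^-1 / 2 /\
  forall w', rat_cube q w' -> `|w' - w| <= r.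
Proof.
move=> r0; pose m := Num.truncn (2 / r); pose rho : R := m.+1%:R^-1.
have rho0 : 0 < rho by rewrite invr_gt0 ltr0n.
have rhor : 2 * rho <= r.
  rewrite ler_pdivrMr ?ltr0n// mulrC -ler_pdivrMr//.
  by rewrite ltW// truncnS_gt.
have near (a : R) : exists q : rat, `|a - ratr q| <= rho / 2.
  have [|q] := @rat_in_itvoo R (a - rho / 2) (a + rho / 2); first by lra.
  rewrite in_itv /= => /andP[q1 q2]; exists q.
  by rewrite ler_norml; apply/andP; split; lra.
have [b hb] := near w.2.
have /choice[a ha] := fun i => near (w.1 i 0).
have wq : `|w - rat_center (\col_i a i, b, m)| <= rho / 2.
  apply/pair_norm_leP; split => //=; apply/mx_norm_leP; first by lra.
  by move=> i j; rewrite !mxE ord1.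
exists (\col_i a i, b, m); split => // w' w'q.
rewrite -(subrKA (rat_center (\col_i a i, b, m))).
apply: (le_trans (ler_normD _ _)); rewrite [X in _ + X]distrC.
move: w'q; rewrite /rat_cube /= -/rho => w'q.
by lra.
Qed.

(** A Lindelof argument: every point of [S] lies in a rational cube small enough for its trace on
    [S] to be null, and there are countably many such cubes. *)
Lemma cube_null_local S :
  (forall w, S w -> exists2 r : R, 0 < r &
    cube_null (S `&` [set w' | `|w' - w| <= r])) -> cube_null S.
Proof.
move=> h.
pose F q := if `[< cube_null (S `&` rat_cube q) >] then S `&` rat_cube q else set0.
apply: (@cube_null_sub _ _ _ (\bigcup_q F q)).
  move=> w Sw; have [r r0 Nr] := h _ Sw.
  have [q [wq qr]] := rat_cube_dense w r0.
  exists q => //; rewrite /F asboolT.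
    split=> //; rewrite /rat_cube /=; apply: (le_trans wq).
    by rewrite ler_pdivrMr// ler_peMr ?invr_ge0// ler1n.
  by apply: cube_null_sub Nr => w' [? /qr].
apply: cube_null_bigcup_count => q; rewrite /F.
by case: asboolP => // _; exact: cube_null_set0.
Qed.

(** Replacing the last coordinate by 0 has a Lipschitz inverse on [S], and the image lies in a
    hyperplane. *)
Lemma cube_null_graph (C : R) S :
  (forall w w', S w -> S w' -> `|w.2 - w'.2| <= C * `|w.1 - w'.1|) ->
  cube_null S.
Proof.
move=> lip; apply: (@cube_null_pullback _ _ (`|C| + 1) _ (fun w => (w.1, 0))).
  move=> w w' Sw Sw'; have l := lip _ _ Sw Sw'.
  have -> : `|(w.1, 0) - (w'.1, 0) : V| = `|w.1 - w'.1|.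
    by rewrite prod_normE /= subr0 normr0; apply/max_idPl.
  apply/pair_norm_leP; split => /=.
    by rewrite ler_peMl// lerDr.
  apply: (le_trans l); rewrite ler_wpM2r//.
  by rewrite ler_wpDr// ler_norm.
apply: (@cube_null_sub _ _ _ [set w | w.2 = 0]); last exact: cube_null_hyperplane.
by move=> _ [w _ <-].
Qed.

(** The displacement along [v] is controlled by the remaining one. [F] projects along [v] onto the
    vectors with i-th coordinate 0 and stores the stepsize in that freed coordinate, so its image
    lies in the hyperplane [w.2 = 0]. *)
Lemma cube_null_graph_dir (v : 'cV[R]_n) i (C : R) S : v i 0 != 0 ->
  (forall w w', S w -> S w' -> `|(w.1 - w'.1) i 0| <=
    C * Num.max `|w.1 - w'.1 - ((w.1 - w'.1) i 0 / v i 0) *: v| `|w.2 - w'.2|) ->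
  cube_null S.
Proof.
move=> vi0 lip.
pose F (w : V) : V :=
  (w.1 - (w.1 i 0 / v i 0) *: v + w.2 *: delta_mx i 0, 0).
apply: (@cube_null_pullback _ _ (1 + `|C| * `|v| / `|v i 0| + `|C|) _ F).
  move=> w w' Sw Sw'; have /= := lip _ _ Sw Sw'.
  set dx := w.1 - w'.1; set da := w.2 - w'.2.
  set p := dx - _; set m := Num.max _ _ => l.
  have FE : F w - F w' = (p + da *: delta_mx i 0, 0).
    rewrite /F; congr pair; last by rewrite /= subr0.
    apply/matrixP => k j; rewrite /p /dx /da !mxE; ring.
  have pi : p i 0 = 0 by rewrite !mxE divfK// subrr.
  have mF : m <= `|F w - F w'|.
    rewrite FE ge_max; apply/andP; split.
      apply/mx_norm_leP => // k j; rewrite ord1.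
      have [->|ki] := eqVneq k i; first by rewrite pi normr0.
      have := (@pair_norm_leP _ _ (p + da *: delta_mx i 0, 0) _).1 (lexx _).
      move=> [/= h _]; apply: le_trans h.
      have := ler_mx_norm_entry (p + da *: delta_mx i 0) k 0.
      have dk0 : (da *: (delta_mx i 0 : 'cV[R]_n)) k 0 = 0.
        by rewrite !mxE (negbTE ki) mulr0.
      by rewrite [X in `|X| <= _]mxE dk0 addr0.
    have := (@pair_norm_leP _ _ (p + da *: delta_mx i 0, 0) _).1 (lexx _).
    move=> [/= h _]; apply: le_trans h.
    have := ler_mx_norm_entry (p + da *: delta_mx i 0) i 0.
    by rewrite mxE pi add0r !mxE !eqxx mulr1.
  have m0 : 0 <= m by rewrite le_max normr_ge0.
  have pm : `|p| <= m by rewrite le_max lexx.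
  have dam : `|da| <= m by rewrite le_max lexx orbT.
  have lC : `|dx i 0| <= `|C| * m.
    by apply: (le_trans l); rewrite ler_wpM2r// ler_norm.
  have dxm : `|dx| <= m + `|C| * `|v| / `|v i 0| * m.
    have -> : dx = p + (dx i 0 / v i 0) *: v by rewrite subrK.
    apply: (le_trans (ler_normD _ _)); rewrite lerD//.
    rewrite normrZ normrM normfV mulrAC [leRHS]mulrAC ler_wpM2r ?invr_ge0//.
    by rewrite mulrAC ler_wpM2r.
  have Cv : 0 <= `|C| * `|v| / `|v i 0| by rewrite divr_ge0// mulr_ge0.
  apply: (@le_trans _ _ ((1 + `|C| * `|v| / `|v i 0| + `|C|) * m)); last first.
    by rewrite ler_wpM2l// addr_ge0// addr_ge0.
  apply/pair_norm_leP; split => /=.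
    apply: (le_trans dxm); rewrite !mulrDl mul1r lerDl.
    by rewrite mulr_ge0.
  apply: (le_trans dam); rewrite ler_peMl// -addrA lerDl addr_ge0//.
apply: (@cube_null_sub _ _ _ [set w | w.2 = 0]); last exact: cube_null_hyperplane.
by move=> _ [w _ <-].
Qed.

End rational_cubes.

(** * From cube covers to Lebesgue negligible sets *)

Section negligible.
Variables (R : realType) (n : nat).
Local Notation mu := (lebesgue_tuple R n \x @lebesgue_measure R)%E.

Definition tuple_cube (c : 'cV[R]_n * R) (r : R) :
    set (n.-tuple (measurableTypeR R) * measurableTypeR R) :=
  [set t | forall i, `[c.1 i 0 - r, c.1 i 0 + r]%classic (tnth t i)] `*`
  `[c.2 - r, c.2 + r]%classic.

Lemma measurable_tuple_box (X : 'I_n -> set (measurableTypeR R)) :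
  (forall i, measurable (X i)) ->
  measurable [set t : n.-tuple (measurableTypeR R) | forall i, X i (tnth t i)].
Proof.
move=> mX; rewrite [X in measurable X](_ : _ = \bigcap_(i in [set: 'I_n])
    ((@tnth n (measurableTypeR R))^~ i @^-1` X i)).
  apply: fin_bigcap_measurable => // i _; rewrite -[X in measurable X]setTI.
  exact: measurable_tnth.
by apply/seteqP; split => t /= tX i; [move=> _|]; apply: tX.
Qed.

Lemma measurable_tuple_cube c r : measurable (tuple_cube c r).
Proof.
apply: measurableX => //.
exact: (@measurable_tuple_box (fun i => `[c.1 i 0 - r, c.1 i 0 + r]%classic)
  (fun i => measurable_itv _)).
Qed.

Lemma measure_tuple_cube c r : 0 <= r ->
  mu (tuple_cube c r) = ((2 * r) ^+ n.+1)%:E.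
Proof.
move=> r0.
have itv (a : R) : lebesgue_measure `[a - r, a + r]%classic = (2 * r)%:E.
  rewrite lebesgue_measure_itv /= lte_fin; case: ltP => [_|ar].
    by rewrite -EFinD; congr EFin; ring.
  by congr EFin; lra.
rewrite product_measure1E//; last first.
  exact: (@measurable_tuple_box (fun i => `[c.1 i 0 - r, c.1 i 0 + r]%classic)
    (fun i => measurable_itv _)).
have box := @lebesgue_tuple_box R n
  (fun i => `[c.1 i 0 - r, c.1 i 0 + r]%classic) (fun i => measurable_itv _).
transitivity ((\prod_(i < n) (2 * r)%:E) * (2 * r)%:E)%E.
  congr (_ * _)%E; last exact: itv.
  by apply: (etrans box); apply: eq_bigr => i _; exact: itv.
by rewrite prodEFin prodr_const card_ord -EFinM exprSr.
Qed.

(** The unions [U m] of covers have measure at most 1 / (m + 1), and their intersection is the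
    measurable null set wanted. The budget is divided by [2 ^+ n.+1] because a cube of radius r has
    side 2 r. *)
Lemma cube_null_negligible (S : set ('cV[R]_n * R)) : cube_null S ->
  mu.-negligible [set z | S (col_of_tuple z.1, z.2)].
Proof.
move=> h.
have /choice[c /choice[r cr]] : forall m, exists c : nat -> 'cV[R]_n * R,
    exists r : nat -> R, [/\ forall j, 0 <= r j,
    forall w, S w -> exists j, `|w - c j| <= r j &
    forall N, \sum_(j < N) r j ^+ n.+1 <= m.+1%:R^-1 / 2 ^+ n.+1].
  by move=> m; apply: h; rewrite divr_gt0 ?invr_gt0 ?ltr0n ?exprn_gt0.
pose U m := \bigcup_j tuple_cube (c m j) (r m j).
have mU m : measurable (U m).
  by apply: bigcupT_measurable => j; exact: measurable_tuple_cube.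
have muU m : (mu (U m) <= (m.+1%:R^-1)%:E)%E.
  have [r0 _ sum] := cr m.
  apply: (le_trans (measure_sigma_subadditive _ _ (mU m) (@subset_refl _ _))).
    by move=> j; exact: measurable_tuple_cube.
  apply: lime_le; first by apply: is_cvg_nneseries => k _ _; exact: measure_ge0.
  apply: nearW => N; rewrite big_mkord.
  rewrite (eq_bigr (fun j : 'I_N => ((2 * r m j) ^+ n.+1)%:E)); last first.
    by move=> j _; exact: measure_tuple_cube.
  rewrite sumEFin lee_fin; under eq_bigr do rewrite exprMn.
  rewrite -mulr_sumr mulrC -ler_pdivlMr ?exprn_gt0//; exact: sum.
exists (\bigcap_m U m); split; first exact: bigcapT_measurable.
  apply/eqP; rewrite eq_le measure_ge0 andbT; apply/lee_addgt0Pr => e e0.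
  rewrite add0e; pose m := Num.truncn e^-1.
  apply: (@le_trans _ _ (mu (U m))).
    apply: le_measure; rewrite ?inE//; first exact: bigcapT_measurable.
    by move=> z; apply.
  apply: (le_trans (muU m)); rewrite lee_fin invf_ple ?posrE ?ltr0n//.
  by rewrite ltW// truncnS_gt.
move=> [t a] /= Sz m _; have [_ cov _] := cr m.
have [j /pair_norm_leP[/= hx ha]] := cov _ Sz; exists j => //; split => /=.
  move=> i; have := le_trans (ler_mx_norm_entry _ i 0) hx.
  rewrite !mxE ler_norml in_itv /= => /andP[? ?].
  by apply/andP; split; lra.
move: ha; rewrite ler_norml in_itv /= => /andP[? ?].
by apply/andP; split; lra.
Qed.

End negligible.

(** * Quadratic forms and local Lipschitz bounds *)

Section dot_product.
Variables (R : realType) (n : nat).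
Implicit Types (x y z : 'cV[R]_n) (M : 'M[R]_n) (a : R).

Definition dot x y : R := (x^T *m y) 0 0.

Lemma dotE x y : dot x y = \sum_i x i 0 * y i 0.
Proof. by rewrite /dot mxE; apply: eq_bigr => i _; rewrite mxE. Qed.

Lemma quad_formE M x : quad_form M x = dot x (M *m x).
Proof. by rewrite /quad_form /dot mulmxA. Qed.

Lemma dotC x y : dot x y = dot y x.
Proof. by rewrite !dotE; apply: eq_bigr => i _; rewrite mulrC. Qed.

Lemma dotDl x y z : dot (x + y) z = dot x z + dot y z.
Proof. by rewrite /dot linearD mulmxDl mxE. Qed.

Lemma dotDr x y z : dot z (x + y) = dot z x + dot z y.
Proof. by rewrite dotC dotDl !(dotC z). Qed.

Lemma dotNl x y : dot (- x) y = - dot x y.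
Proof. by rewrite /dot linearN mulNmx mxE. Qed.

Lemma dotNr x y : dot x (- y) = - dot x y.
Proof. by rewrite dotC dotNl dotC. Qed.

Lemma dotZl a x y : dot (a *: x) y = a * dot x y.
Proof. by rewrite /dot linearZ -scalemxAl mxE. Qed.

Lemma dotZr a x y : dot x (a *: y) = a * dot x y.
Proof. by rewrite dotC dotZl dotC. Qed.

Lemma dot0l x : dot 0 x = 0.
Proof. by rewrite /dot trmx0 mul0mx mxE. Qed.

Lemma dot0r x : dot x 0 = 0.
Proof. by rewrite dotC dot0l. Qed.

Lemma dot_mulmxr M x y : dot x (M *m y) = dot (M^T *m x) y.
Proof. by rewrite /dot trmx_mul trmxK mulmxA. Qed.

Lemma dot_sym M x y : M^T = M -> dot x (M *m y) = dot y (M *m x).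
Proof. by move=> Ms; rewrite dot_mulmxr Ms dotC. Qed.

Definition dot_linE := (mulmxDr, mulmxDl, mulmxN, mulNmx, dotDl, dotDr, dotNl,
  dotNr, =^~ scalemxAl, =^~ scalemxAr, dotZl, dotZr).

Lemma outer_mulmx x y z : (x *m y^T) *m z = dot y z *: x.
Proof.
by rewrite -mulmxA [y^T *m z]mx11_scalar mul_mx_scalar.
Qed.

Lemma dot_ge0 x : 0 <= dot x x.
Proof. by rewrite dotE sumr_ge0// => i _; rewrite -expr2 sqr_ge0. Qed.

Lemma dot_subr_le x y : dot (x - y) (x - y) <= 2 * dot x x + 2 * dot y y.
Proof.
rewrite -subr_ge0 (_ : _ - _ = dot (x + y) (x + y)) ?dot_ge0//.
by rewrite !dot_linE (dotC y x); ring.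
Qed.

Lemma sqr_norm_le_dot x : `|x| ^+ 2 <= dot x x.
Proof.
have d0 := dot_ge0 x.
rewrite -[leRHS]sqr_sqrtr// lerXn2r ?nnegrE ?sqrtr_ge0//.
apply/mx_norm_leP; first exact: sqrtr_ge0.
move=> i j; rewrite ord1 -sqrtr_sqr ler_wsqrtr// dotE (bigD1 i)//= -expr2 lerDl.
by rewrite sumr_ge0// => k _; rewrite -expr2 sqr_ge0.
Qed.

Lemma dot_eq0 x : dot x x = 0 -> x = 0.
Proof.
move=> d0; apply/eqP; rewrite -normr_eq0 -sqrf_eq0 eq_le sqr_ge0 andbT.
by rewrite -d0 sqr_norm_le_dot.
Qed.

Lemma dot_gt0 x : x != 0 -> 0 < dot x x.
Proof.
move=> x0; rewrite lt_neqAle dot_ge0 andbT eq_sym.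
by apply: contra x0 => /eqP/dot_eq0 ->.
Qed.

Lemma norm_dot_le x y : `|dot x y| <= n%:R * (`|x| * `|y|).
Proof.
rewrite dotE; apply: (le_trans (ler_norm_sum _ _ _)).
rewrite -[X in X%:R](card_ord n) -sum1_card natr_sum mulr_suml.
apply: ler_sum => i _; rewrite mul1r normrM ler_pM//; exact: ler_mx_norm_entry.
Qed.

Lemma norm_mulmx_le M x : `|M *m x| <= n%:R * (`|M| * `|x|).
Proof.
apply/mx_norm_leP; first by rewrite !mulr_ge0.
move=> i j; rewrite ord1 mxE; apply: (le_trans (ler_norm_sum _ _ _)).
rewrite -[X in X%:R](card_ord n) -sum1_card natr_sum mulr_suml.
apply: ler_sum => k _; rewrite mul1r normrM ler_pM//; exact: ler_mx_norm_entry.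
Qed.

Lemma norm_bil_le M x y : `|dot x (M *m y)| <= n%:R ^+ 2 * `|M| * (`|x| * `|y|).
Proof.
apply: (le_trans (norm_dot_le _ _)); rewrite expr2 -!mulrA ler_wpM2l//.
have -> : n%:R * (`|M| * (`|x| * `|y|)) = `|x| * (n%:R * (`|M| * `|y|)) by ring.
by rewrite ler_wpM2l// norm_mulmx_le.
Qed.

Lemma norm_quad_le M x : `|dot x (M *m x)| <= n%:R ^+ 2 * `|M| * dot x x.
Proof.
apply: (le_trans (norm_bil_le _ _ _)); rewrite -expr2 ler_wpM2l ?mulr_ge0//.
exact: sqr_norm_le_dot.
Qed.

Lemma psd_cauchy_schwarz M x y : M^T = M -> (forall z, 0 <= dot z (M *m z)) ->
  dot x (M *m y) ^+ 2 <= dot x (M *m x) * dot y (M *m y).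
Proof.
move=> Ms M0; set a := dot x (M *m x); set b := dot x _; set c := dot y _.
have q s t : 0 <= s ^+ 2 * a + 2 * s * t * b + t ^+ 2 * c.
  have := M0 (s *: x + t *: y).
  rewrite !dot_linE (dot_sym y x Ms) -/a -/b -/c.
  by congr (_ <= _); ring.
have a0 : 0 <= a := M0 x.
have := M0 y; rewrite -/c le_eqVlt => /orP[/eqP c0|c0].
  have [b0|b0] := eqVneq b 0; first by rewrite b0 -c0 expr0n mulr0.
  (* If the form vanishes at [y] while b is nonzero, it is affine in t and this t gives the value
     -1. *)
  have := q 1 (- (a + 1) / (2 * b)); rewrite -c0 mulr0 addr0.
  have -> : 1 ^+ 2 * a + 2 * 1 * (- (a + 1) / (2 * b)) * b = -1 by field.
  by rewrite ler0N1.
have := q c (- b).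
have -> : c ^+ 2 * a + 2 * c * (- b) * b + (- b) ^+ 2 * c = c * (a * c - b ^+ 2).
  by ring.
by rewrite pmulr_rge0// subr_ge0.
Qed.

Lemma unitmx_inj M : (forall x, M *m x = 0 -> x = 0) -> M \in unitmx.
Proof.
move=> inj; rewrite -unitmx_tr -row_free_unit -kermx_eq0.
apply/eqP/row_matrixP => i; rewrite row0; apply: trmx_inj; rewrite trmx0.
apply: inj; apply: trmx_inj; rewrite trmx_mul trmxK trmx0.
by rewrite -row_mul mulmx_ker row0.
Qed.

(** Cauchy-Schwarz for [M] at x and M^-1 x gives |x|^4 <= (x' M x) (x' M^-1 x), and the last factor
    is at most K |x|^2. *)
Lemma pd_lower_bound M : M^T = M -> (forall x, x != 0 -> 0 < dot x (M *m x)) ->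
  exists2 c : R, 0 < c & forall x, c * dot x x <= dot x (M *m x).
Proof.
move=> Ms pos.
have M0 z : 0 <= dot z (M *m z).
  by have [->|/pos/ltW//] := eqVneq z 0; rewrite dot0l.
have Mu : M \in unitmx.
  apply: unitmx_inj => x Mx; apply/eqP; apply: contraT => /pos.
  by rewrite Mx dot0r ltxx.
pose K := n%:R ^+ 2 * `|invmx M| + 1.
have K0 : 0 < K by rewrite ltr_wpDl// !mulr_ge0.
exists K^-1; first by rewrite invr_gt0.
move=> x; rewrite mulrC ler_pdivrMr//.
have [->|x0] := eqVneq x 0; first by rewrite !dot0l mul0r.
have := psd_cauchy_schwarz x (invmx M *m x) Ms M0.
rewrite mulmxA mulmxV// mul1mx => h; rewrite -(ler_pM2r (dot_gt0 x0)).
rewrite -expr2; apply: (le_trans h); rewrite -mulrA ler_wpM2l//.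
rewrite dotC; apply: (le_trans (ler_norm _)); apply: (le_trans (norm_quad_le _ _)).
by rewrite ler_wpM2r ?dot_ge0// lerDl.
Qed.

(* [H Y H = H] for the partial inverse [Y], so [x' H x = (H x)' Y (H x)]. *)
Lemma quad_le_sqr_image M : M^T = M ->
  exists2 C : R, 0 < C & forall x, `|dot x (M *m x)| <= C * dot (M *m x) (M *m x).
Proof.
move=> Ms; exists (n%:R ^+ 2 * `|pinvmx M| + 1); first by rewrite ltr_wpDl// !mulr_ge0.
move=> x; have E : M *m x = M *m (pinvmx M *m (M *m x)).
  by rewrite 2!mulmxA (mulmxKpV (submx_refl M)).
rewrite [X in dot x X]E dot_mulmxr Ms.
apply: (le_trans (norm_quad_le _ _)).
by rewrite ler_wpM2r ?dot_ge0// lerDl.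
Qed.

End dot_product.

(** * Calculus of locally Lipschitz functions *)

Section locally_lipschitz.
Variables (R : realType) (X : normedModType R).
Implicit Types (f g : X -> R) (a : X).

(** The bound compares any two points of a ball around [a]. It passes through sums, products,
    inverses and square roots, and yields both continuity at [a] and the two-point estimates for the
    Hessian entries. *)
Definition loclip f a := exists r C, [/\ 0 < r, 0 <= C & forall u v,
  `|u - a| <= r -> `|v - a| <= r -> `|f u - f v| <= C * `|u - v|].

Lemma loclip_cst (c : R) a : loclip (fun=> c) a.
Proof. by exists 1, 0; split => // u v _ _; rewrite subrr normr0 mul0r. Qed.

Lemma loclip_lip (C : R) f a : (forall u v, `|f u - f v| <= C * `|u - v|) ->
  loclip f a.
Proof.
move=> h; exists 1, `|C|; split => // u v _ _; apply: (le_trans (h u v)).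
by rewrite ler_wpM2r// ler_norm.
Qed.

Lemma loclip_add f g a : loclip f a -> loclip g a -> loclip (fun x => f x + g x) a.
Proof.
move=> [r [C [r0 C0 hf]]] [r' [C' [r'0 C'0 hg]]].
exists (Num.min r r'), (C + C'); split; rewrite ?lt_min ?r0 ?addr_ge0// => u v.
rewrite !le_min => /andP[ur ur'] /andP[vr vr'].
rewrite opprD addrACA mulrDl; apply: (le_trans (ler_normD _ _)).
by rewrite lerD ?hf ?hg.
Qed.

Lemma loclip_opp f a : loclip f a -> loclip (fun x => - f x) a.
Proof.
move=> [r [C [r0 C0 hf]]]; exists r, C; split => // u v ur vr.
by rewrite -opprD normrN hf.
Qed.

Lemma loclip_cont f a e : loclip f a -> 0 < e ->
  exists2 r, 0 < r & forall u, `|u - a| <= r -> `|f u - f a| <= e.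
Proof.
move=> [r [C [r0 C0 h]]] e0.
exists (Num.min r (e / (C + 1))).
  by rewrite lt_min r0 divr_gt0// ltr_wpDl.
move=> u; rewrite le_min => /andP[ur ue].
apply: (le_trans (h _ _ ur _)); first by rewrite subrr normr0 ltW.
move: ue; rewrite ler_pdivlMr ?ltr_wpDl// => ue; apply: le_trans ue.
by rewrite mulrC ler_wpM2l// lerDl.
Qed.

Lemma loclip_bound f a : loclip f a ->
  exists r M, [/\ 0 < r, 0 <= M & forall u, `|u - a| <= r -> `|f u| <= M].
Proof.
move=> h; have [r r0 hr] := loclip_cont h ltr01.
exists r, (`|f a| + 1); split; rewrite ?addr_ge0// => u /hr h1.
have := ler_normD (f u - f a) (f a); rewrite subrK; lra.
Qed.

Lemma loclip_mul f g a : loclip f a -> loclip g a -> loclip (fun x => f x * g x) a.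
Proof.
move=> lf lg; have [rf [M [rf0 M0 bf]]] := loclip_bound lf.
have [rg [N [rg0 N0 bg]]] := loclip_bound lg.
move: lf lg => [r [C [r0 C0 hf]]] [r' [C' [r'0 C'0 hg]]].
exists (Num.min (Num.min r r') (Num.min rf rg)), (C * N + M * C').
split; rewrite ?lt_min ?r0 ?r'0 ?rf0 ?addr_ge0 ?mulr_ge0// => u v.
rewrite !le_min => /andP[/andP[ur ur'] /andP[uf ug]] /andP[/andP[vr vr'] /andP[vf vg]].
have -> : f u * g u - f v * g v = (f u - f v) * g u + f v * (g u - g v) by ring.
apply: (le_trans (ler_normD _ _)); rewrite [leRHS]mulrDl !normrM lerD//.
  by rewrite mulrAC ler_pM ?hf ?bg.
by rewrite -mulrA ler_pM ?hg ?bf.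
Qed.

Lemma loclip_sum (I : Type) (s : seq I) (P : pred I) (f : I -> X -> R) a :
  (forall i, loclip (f i) a) -> loclip (fun x => \sum_(i <- s | P i) f i x) a.
Proof.
move=> h; elim: s => [|i s IH].
  by under eq_fun do rewrite big_nil; exact: loclip_cst.
under eq_fun do rewrite big_cons.
by case: (P i) => //; exact: loclip_add.
Qed.

Lemma loclip_pos f a : loclip f a -> 0 < f a ->
  exists2 r, 0 < r & forall u, `|u - a| <= r -> f a / 2 <= f u.
Proof.
move=> h fa; have [|r r0 hr] := loclip_cont h (e := f a / 2); first by rewrite divr_gt0.
exists r => // u /hr; rewrite ler_norml => /andP[? _]; lra.
Qed.

Lemma loclip_inv f a : loclip f a -> 0 < f a -> loclip (fun x => (f x)^-1) a.
Proof.
move=> lf fa; have [r r0 hr] := loclip_pos lf fa.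
move: lf => [r' [C [r'0 C0 h]]].
exists (Num.min r r'), (C / (f a / 2) ^+ 2).
split; rewrite ?lt_min ?r0 ?divr_ge0 ?sqr_ge0// => u v.
rewrite !le_min => /andP[/hr ur ur'] /andP[/hr vr vr'].
have fa2 : 0 < f a / 2 by rewrite divr_gt0.
have fu := lt_le_trans fa2 ur; have fv := lt_le_trans fa2 vr.
have -> : (f u)^-1 - (f v)^-1 = - (f u - f v) / (f u * f v).
  by field; rewrite !gt_eqF.
rewrite normrM normrN normfV mulrAC ler_pM ?invr_ge0 ?h//.
rewrite ger0_norm ?mulr_ge0 ?(ltW fu) ?(ltW fv)//.
by rewrite lef_pV2 ?posrE ?exprn_gt0 ?mulr_gt0// expr2 ler_pM// ltW.
Qed.

Lemma loclip_sqrt f a : loclip f a -> 0 < f a -> loclip (fun x => Num.sqrt (f x)) a.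
Proof.
move=> lf fa; have [r r0 hr] := loclip_pos lf fa.
move: lf => [r' [C [r'0 C0 h]]].
have fa2 : 0 < f a / 2 by rewrite divr_gt0.
exists (Num.min r r'), (C / Num.sqrt (f a / 2)).
split; rewrite ?lt_min ?r0 ?divr_ge0 ?sqrtr_ge0// => u v.
rewrite !le_min => /andP[/hr ur ur'] /andP[/hr vr vr'].
have fu := lt_le_trans fa2 ur; have fv := lt_le_trans fa2 vr.
have su : 0 < Num.sqrt (f u) by rewrite sqrtr_gt0.
have sv : 0 < Num.sqrt (f v) by rewrite sqrtr_gt0.
have -> : Num.sqrt (f u) - Num.sqrt (f v) =
    (f u - f v) / (Num.sqrt (f u) + Num.sqrt (f v)).
  rewrite -{2}(sqr_sqrtr (ltW fu)) -{2}(sqr_sqrtr (ltW fv)); field.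
  by rewrite gt_eqF// addr_gt0.
rewrite normrM normfV mulrAC ler_pM ?invr_ge0 ?h//.
rewrite ger0_norm ?addr_ge0 ?(ltW su) ?(ltW sv)//.
rewrite lef_pV2 ?posrE ?sqrtr_gt0 ?addr_gt0//.
by rewrite (le_trans (ler_wsqrtr ur))// lerDl ltW.
Qed.

End locally_lipschitz.

(** * Gradient and Hessian of the objective *)

Section derivative_from_slope.
Variable R : realType.

(** The difference quotient is exactly [phi h] for small nonzero h, so continuity of [phi] at 0
    gives the limit. *)
Lemma derive_slope (V : normedModType R) (f : V -> R) (x v : V) (phi : R -> R) (r : R) :
  0 < r -> loclip phi 0 ->
  (forall h, `|h| <= r -> f (h *: v + x) - f x = h * phi h) -> 'D_v f x = phi 0.
Proof.
move=> r0 lphi slope; rewrite /derive; apply: cvg_lim => //.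
apply/cvgrPdist_le => e e0; have [r' r'0 h'] := loclip_cont lphi e0.
have : \forall h \near (0 : R)^', `|h| <= Num.min r r'.
  apply: nbhs_dnbhs; apply/nbhs_normP; exists (Num.min r r') => /=.
    by rewrite lt_min r0.
  by move=> h /=; rewrite sub0r normrN => /ltW.
apply: filterS2 (nbhs_dnbhs_neq (0 : R)) => h hn0.
rewrite le_min => /andP[hr hr'] /=; rewrite slope// distrC.
rewrite [_ *: _]mulrA mulVf// mul1r; apply: h'.
by rewrite subr0.
Qed.

End derivative_from_slope.

Section objective.
Variables (R : realType) (n : nat) (A B : 'M[R]_n).
Hypotheses (hA : psdmx A) (hB : pdmx B).
Implicit Types x y u v : 'cV[R]_n.

Let As : A^T = A := hA.1.
Let Bs : B^T = B := hB.1.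

Lemma psdA x : 0 <= dot x (A *m x).
Proof. by rewrite -quad_formE; apply: hA.2. Qed.

Definition anorm x : R := Num.sqrt (dot x (A *m x)).

Lemma anorm_ge0 x : 0 <= anorm x. Proof. exact: sqrtr_ge0. Qed.

Lemma anorm_sqr x : anorm x ^+ 2 = dot x (A *m x).
Proof. by rewrite sqr_sqrtr// psdA. Qed.

Lemma anorm_cauchy_schwarz x y : dot x (A *m y) <= anorm x * anorm y.
Proof.
rewrite /anorm -sqrtrM ?psdA//; apply: (le_trans (ler_norm _)).
by rewrite -sqrtr_sqr ler_wsqrtr// psd_cauchy_schwarz//; exact: psdA.
Qed.

(** Cauchy-Schwarz at [A *m x] and x gives |A x|^2 <= s (A x) s x, so s x = 0 forces A x = 0. *)
Lemma anorm_gt0 x : (0 < anorm x) = (A *m x != 0).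
Proof.
apply/idP/idP => [|Ax].
  by apply: contraTN => /eqP Ax; rewrite /anorm Ax dot0r sqrtr0 ltxx.
rewrite lt_neqAle anorm_ge0 andbT eq_sym; apply: contra Ax => /eqP s0.
have := anorm_cauchy_schwarz (A *m x) x; rewrite s0 mulr0 => d0.
by apply/eqP/dot_eq0/eqP; rewrite eq_le dot_ge0 d0.
Qed.

Lemma objectiveE x : objective A B x = dot x (B *m x) - anorm x.
Proof. by rewrite /objective !quad_formE. Qed.

Definition psi x : 'cV[R]_n := (anorm x)^-1 *: (A *m x).

(** The second term comes from 1 / s x - 1 / s y, since (s x)^2 - (s y)^2 is the product of A (x +
    y) with x - y. At y = x it is the Jacobian A / s - (A x) (A x)' / s^3 of [psi], so [hess] is the
    classical Hessian. *)
Definition psi_slope x y : 'M[R]_n := (anorm x)^-1 *: A -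
  ((anorm x + anorm y) * anorm x * anorm y)^-1 *:
    ((A *m y) *m (A *m (x + y))^T).

Definition grad x : 'cV[R]_n := 2 *: (B *m x) - psi x.

Definition hess x : 'M[R]_n := 2 *: B - psi_slope x x.

Lemma psi_slopeP x y : 0 < anorm x -> 0 < anorm y ->
  psi x - psi y = psi_slope x y *m (x - y).
Proof.
move=> x0 y0; rewrite /psi_slope mulmxBl -!scalemxAl outer_mulmx.
set d := dot _ _.
have dE : d = anorm x ^+ 2 - anorm y ^+ 2.
  rewrite /d !anorm_sqr dotC !dot_linE (dot_sym y x As).
  by ring.
rewrite mulmxBr !scalerBr !scalerA -addrA; congr (_ + _).
rewrite -!scaleNr -scalerDl dE; congr (_ *: _).
rewrite -[X in _ + X]/(_ * _); field.
by rewrite !gt_eqF// addr_gt0.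
Qed.

Lemma psi_slope_entry x y i j : psi_slope x y i j = (anorm x)^-1 * A i j -
  ((anorm x + anorm y) * anorm x * anorm y)^-1 *
  ((A *m y) i 0 * ((A *m x) j 0 + (A *m y) j 0)).
Proof.
by rewrite /psi_slope mulmxDr !mxE big_ord1 !mxE.
Qed.

Lemma hess_entry x i j : hess x i j = 2 * B i j - psi_slope x x i j.
Proof. by rewrite mxE [X in X + _]mxE [X in _ + X]mxE. Qed.

Lemma hess_tr x : (hess x)^T = hess x.
Proof.
apply/matrixP => i j; rewrite mxE !hess_entry !psi_slope_entry.
have Aij : A j i = A i j by rewrite -{1}As mxE.
have Bij : B j i = B i j by rewrite -{1}Bs mxE.
by rewrite Aij Bij; ring.
Qed.

Lemma psi_slopeZ (t : R) x : 0 < t -> psi_slope (t *: x) (t *: x) = t^-1 *: psi_slope x x.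
Proof.
move=> t0.
have st : anorm (t *: x) = t * anorm x.
  by rewrite /anorm !dot_linE mulrA -expr2 sqrtrM ?sqr_ge0// sqrtr_sqr gtr0_norm.
have outer (u w : 'cV[R]_n) : (t *: u) *m (t *: w)^T = t ^+ 2 *: (u *m w^T).
  by rewrite linearZ /= -scalemxAl -scalemxAr scalerA.
have tD : t *: x + t *: x = t *: (x + x) by rewrite scalerDr.
rewrite /psi_slope st tD -!scalemxAr outer scalerBr !scalerA.
congr (_ *: _ - _ *: _); first by rewrite invfM.
have [->|s0] := eqVneq (anorm x) 0; first by rewrite !mulr0 invr0 !(mul0r, mulr0).
have sp : 0 < anorm x by rewrite lt_neqAle eq_sym s0 anorm_ge0.
by field; rewrite !gt_eqF ?addr_gt0 ?mulr_gt0.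
Qed.

Section entries.
Variable X : normedModType R.
Variables (F G : X -> 'cV[R]_n) (C : R) (a : X).
Hypotheses (lF : forall p q, `|F p - F q| <= C * `|p - q|)
  (lG : forall p q, `|G p - G q| <= C * `|p - q|).

Lemma loclip_entry i : loclip (fun p => F p i 0) a.
Proof.
apply: (@loclip_lip _ _ C) => u v; apply: le_trans (lF u v).
by have := ler_mx_norm_entry (F u - F v) i 0; rewrite 2!mxE.
Qed.

Lemma loclip_mulmx (M : 'M[R]_n) i : loclip (fun p => (M *m F p) i 0) a.
Proof.
under eq_fun do rewrite mxE; apply: loclip_sum => j.
apply: loclip_mul; [exact: loclip_cst|exact: loclip_entry].
Qed.

Lemma loclip_anorm : 0 < anorm (F a) -> loclip (fun p => anorm (F p)) a.
Proof.
rewrite sqrtr_gt0 => Fa; apply: loclip_sqrt => //.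
under eq_fun do rewrite dotE; apply: loclip_sum => j.
apply: loclip_mul; [exact: loclip_entry|exact: loclip_mulmx].
Qed.

End entries.

(** The Lipschitz maps [F] and [G] let one statement serve lines through a point, the identity and
    the projections from pairs of points. *)
Lemma loclip_psi_slope (X : normedModType R) (F G : X -> 'cV[R]_n) (C : R) (a : X) i j :
  (forall p q, `|F p - F q| <= C * `|p - q|) ->
  (forall p q, `|G p - G q| <= C * `|p - q|) ->
  0 < anorm (F a) -> 0 < anorm (G a) ->
  loclip (fun p => psi_slope (F p) (G p) i j) a.
Proof.
move=> lF lG Fa Ga; under eq_fun do rewrite psi_slope_entry.
have sF := loclip_anorm lF Fa; have sG := loclip_anorm lG Ga.
apply: loclip_add.
  apply: loclip_mul; last exact: loclip_cst.
  exact: loclip_inv.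
apply: loclip_opp; apply: loclip_mul.
  apply: loclip_inv; last by rewrite !mulr_gt0// addr_gt0.
  by apply: loclip_mul => //; apply: loclip_mul => //; exact: loclip_add.
apply: loclip_mul; first exact: loclip_mulmx lG _ _.
by apply: loclip_add; [exact: loclip_mulmx lF _ _|exact: loclip_mulmx lG _ _].
Qed.

Lemma loclip_grad (X : normedModType R) (F : X -> 'cV[R]_n) (C : R) (a : X) i :
  (forall p q, `|F p - F q| <= C * `|p - q|) -> 0 < anorm (F a) ->
  loclip (fun p => grad (F p) i 0) a.
Proof.
move=> lF Fa.
have -> : (fun p => grad (F p) i 0) =
    (fun p => 2 * (B *m F p) i 0 - (anorm (F p))^-1 * (A *m F p) i 0).
  by apply/funext => p; rewrite /grad /psi mxE [X in X + _]mxE [X in _ + X]mxE [X in _ - X]mxE.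
apply: loclip_add.
  by apply: loclip_mul; [exact: loclip_cst|exact: (loclip_mulmx _ lF)].
apply: loclip_opp; apply: loclip_mul; last exact: (loclip_mulmx _ lF).
by apply: loclip_inv => //; exact: (loclip_anorm lF).
Qed.

Lemma line_lip v x (h k : R) : `|(h *: v + x) - (k *: v + x)| <= `|v| * `|h - k|.
Proof. by rewrite opprD addrACA subrr addr0 -scalerBl normrZ mulrC. Qed.

Lemma anorm_line_pos x v : 0 < anorm x ->
  exists2 r, 0 < r & forall h : R, `|h| <= r -> 0 < anorm (h *: v + x).
Proof.
move=> x0; have F0 : 0 *: v + x = x by rewrite scale0r add0r.
have l : loclip (fun h : R => anorm (h *: v + x)) 0.
  by apply: (loclip_anorm (line_lip v x)); rewrite F0.
have [|r r0 hr] := loclip_pos l; first by rewrite F0.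
exists r => // h hh; apply: (@lt_le_trans _ _ (anorm x / 2)); first by rewrite divr_gt0.
by have := hr h; rewrite subr0 F0; apply.
Qed.

Lemma derive_objective x v : A *m x != 0 -> 'D_v (objective A B) x = dot (grad x) v.
Proof.
rewrite -anorm_gt0 => x0; have [r r0 hr] := anorm_line_pos v x0.
(* The exact difference quotient of the objective: the difference of the two square roots is
   rationalized. *)
pose phi h := 2 * dot x (B *m v) + h * dot v (B *m v) -
  (2 * dot x (A *m v) + h * dot v (A *m v)) / (anorm (h *: v + x) + anorm x).
have F0 : 0 *: v + x = x by rewrite scale0r add0r.
have lid : loclip (fun h : R => h) 0.
  by apply: (@loclip_lip _ _ 1) => ? ?; rewrite mul1r.
rewrite (@derive_slope _ _ _ _ _ phi r) //.
- rewrite /phi !mul0r !addr0 F0 /grad /psi dotDl dotNl !dotZl.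
  rewrite (dotC (B *m x)) (dotC (A *m x)) (dot_sym v x As) (dot_sym v x Bs).
  by field; rewrite !gt_eqF// addr_gt0.
- apply: loclip_add.
    apply: loclip_add; first exact: loclip_cst.
    by apply: loclip_mul => //; exact: loclip_cst.
  apply: loclip_opp; apply: loclip_mul.
    apply: loclip_add; first exact: loclip_cst.
    by apply: loclip_mul => //; exact: loclip_cst.
  apply: loclip_inv; last by rewrite F0 addr_gt0.
  apply: loclip_add; last exact: loclip_cst.
  by apply: (loclip_anorm (line_lip v x)); rewrite F0.
move=> h /hr hp; rewrite !objectiveE /phi.
have sp : anorm (h *: v + x) + anorm x != 0 by rewrite gt_eqF// addr_gt0.
have aE : anorm (h *: v + x) = anorm x + h *
    ((2 * dot x (A *m v) + h * dot v (A *m v)) / (anorm (h *: v + x) + anorm x)).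
  apply: (mulIf sp); rewrite mulrDl -mulrA divfK//.
  have -> : anorm (h *: v + x) * (anorm (h *: v + x) + anorm x) =
      anorm (h *: v + x) ^+ 2 + anorm x * anorm (h *: v + x) by ring.
  rewrite anorm_sqr !dot_linE (dot_sym v x As) -(anorm_sqr x); ring.
by rewrite [X in _ - X - _ = _]aE !dot_linE (dot_sym v x Bs); ring.
Qed.

Lemma gradientE x : A *m x != 0 -> gradient (objective A B) x = grad x.
Proof.
move=> Ax; apply/colP => i; rewrite mxE derive_objective// dotE (bigD1 i)//=.
rewrite [delta_mx _ _ _ _]mxE !eqxx mulr1 big1 ?addr0// => j ji.
by rewrite [delta_mx _ _ _ _]mxE (negbTE ji) mulr0.
Qed.

Lemma hessianE x : A *m x != 0 -> hessian (objective A B) x = hess x.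
Proof.
move=> Ax; have := Ax; rewrite -anorm_gt0 => x0.
(* Entry (i, j) differentiates component j of the gradient along direction i, which yields entry (j,
   i) of the slope matrix; symmetry of [hess] swaps the indices. *)
apply/matrixP => i j; rewrite mxE -(hess_tr x) [RHS]mxE.
have [r r0 hr] := anorm_line_pos (delta_mx i 0) x0.
have F0 : 0 *: delta_mx i 0 + x = x by rewrite scale0r add0r.
rewrite (@derive_slope _ _ _ _ _
  (fun h => (2 *: B) j i - psi_slope (h *: delta_mx i 0 + x) x j i) r) //.
- by rewrite F0 hess_entry [X in X - _]mxE.
- apply: loclip_add; first exact: loclip_cst.
  apply: loclip_opp.
  apply: (@loclip_psi_slope R _ (fun=> x) `|delta_mx i 0 : 'cV[R]_n|);
    rewrite ?F0//; first exact: line_lip.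
  by move=> u v; rewrite subrr normr0 mulr_ge0.
move=> h /hr hp; rewrite !gradientE -?anorm_gt0//.
set y := h *: _ + x.
have -> : grad y j 0 - grad x j 0 = (grad y - grad x) j 0 by rewrite !mxE.
have -> : grad y - grad x = h *: col i (2 *: B - psi_slope y x).
  rewrite /grad opprD addrACA -opprD psi_slopeP// -scalerBr -mulmxBr.
  rewrite scalemxAl -mulmxBl /y addrK -scalemxAr.
  by rewrite colE.
by rewrite !mxE.
Qed.

(** * Consequences of the Hessian bound *)

Section lipschitz.
Variable L : R.
Hypotheses (hA0 : A != 0) (hHess : forall x, A *m x != 0 ->
  loewner_le (hessian (objective A B) x) L%:M).

Lemma hess_le x u : A *m x != 0 -> dot u (hess x *m u) <= L * dot u u.
Proof.
move=> Ax; have [_ /(_ u)] := hHess Ax; rewrite quad_formE hessianE//.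
by rewrite mulmxBl mul_scalar_mx dotDr dotNr dotZr subr_ge0.
Qed.

Lemma exists_nonker : exists x, A *m x != 0.
Proof.
apply: contrapT => no; move/eqP: hA0; apply; apply/matrixP => i j; rewrite [RHS]mxE.
have : A *m delta_mx j 0 = 0 :> 'cV[R]_n.
  by apply/eqP; apply: contraT => h; exfalso; apply: no; exists (delta_mx j 0).
by rewrite -colE => /matrixP/(_ i 0); rewrite !mxE.
Qed.

(* The Hessian at [t x] is [2 B - O(1/t)]. *)
Lemma B_le u : 2 * dot u (B *m u) <= L * dot u u.
Proof.
have [x Ax] := exists_nonker.
set k := dot u (psi_slope x x *m u).
have bound (t : R) : 0 < t -> 2 * dot u (B *m u) - L * dot u u <= t^-1 * k.
  move=> t0; have := @hess_le (t *: x) u.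
  rewrite -scalemxAr scaler_eq0 (gt_eqF t0) /= => /(_ Ax).
  by rewrite /hess psi_slopeZ// mulmxBl -!scalemxAl dotDr dotNr !dotZr -/k; lra.
rewrite leNgt; apply/negP; rewrite -subr_gt0; set d := _ - _ => d0.
have k1 : 0 < `|k| + 1 by rewrite ltr_wpDl.
(* For this t the error [t^-1 * k] is smaller than d. *)
have := bound ((`|k| + 1) / d) (divr_gt0 k1 d0).
rewrite -/d invf_div mulrAC ler_pdivlMr// ler_pM2l//.
by have := ler_norm k; lra.
Qed.

End lipschitz.

End objective.

(** * Convergence to a critical point *)

Section sequences.
Variable R : realType.

Lemma loclip_cvg (X : normedModType R) (f : X -> R) a (u : nat -> X) :
  u k @[k --> \oo] --> a -> loclip f a -> f (u k) @[k --> \oo] --> f a.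
Proof.
move=> ua lf; apply/cvgrPdist_le => e e0; have [r r0 h] := loclip_cont lf e0.
move/cvgrPdist_le : ua => /(_ r r0); apply: filterS => k; rewrite distrC => /h.
by rewrite distrC.
Qed.

Lemma geometric_increments_cvg (u : nat -> R) (M q : R) : 0 <= q < 1 ->
  (forall j, `|u j.+1 - u j| <= M * q ^+ j) -> cvgn u.
Proof.
move=> /andP[q0 q1] h.
have M0 : 0 <= M by have := h 0; rewrite expr0 mulr1; apply: le_trans.
have : cvgn (series (fun j => u j.+1 - u j)).
  apply: normed_cvg; apply: (@series_le_cvg _ _ (geometric M q)) => [j|j|j|] /=.
  - exact: normr_ge0.
  - by rewrite mulr_ge0// exprn_ge0.
  - exact: h.
  - by apply: is_cvg_geometric_series; rewrite ger0_norm.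
have -> : series (fun j => u j.+1 - u j) = (fun k => u k - u 0).
  by apply/funext => k; rewrite /series /= telescope_sumr.
move=> /cvg_ex[l ul]; apply: (@cvgP _ _ (l + u 0)).
have : (fun k => u k - u 0 + u 0) k @[k --> \oo] --> l + u 0.
  by apply: cvgD; [exact: ul|exact: cvg_cst].
by under eq_fun do rewrite subrK.
Qed.

Lemma geometric_increments_cvg_col n (x : nat -> 'cV[R]_n) (M q : R) N : 0 <= q < 1 ->
  (forall j, `|x (N + j).+1 - x (N + j)%N| <= M * q ^+ j) ->
  exists l : 'cV[R]_n, x k @[k --> \oo] --> l.
Proof.
move=> q01 h.
have /choice[l xl] : forall i, exists l, x k i 0 @[k --> \oo] --> (l : R).
  move=> i; have /cvg_ex[l] : cvgn (fun j => x (j + N)%N i 0).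
    apply: (@geometric_increments_cvg _ M q) => // j; rewrite addSn !(addnC _ N).
    apply: le_trans (h j); have := ler_mx_norm_entry (x (N + j).+1 - x (N + j)%N) i 0.
    by rewrite 2!mxE.
  by rewrite (cvg_shiftn N (fun k => x k i 0)) => xl; exists l.
exists (\col_i l i); apply/cvgrPdist_le => e e0.
have : \forall k \near \oo, forall i, `|l i - x k i 0| <= e.
  by apply: filter_forall => i; move/cvgrPdist_le : (xl i); apply.
apply: filterS => k hk; apply/mx_norm_leP; first exact: ltW.
by move=> i j; rewrite ord1 !mxE.
Qed.

End sequences.

(** * Coercivity and the decrease of the objective in one step *)

Section descent.
Variables (R : realType) (n : nat) (A B : 'M[R]_n).
Hypotheses (hA : psdmx A) (hB : pdmx B).
Implicit Types x y u v : 'cV[R]_n.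

Let As : A^T = A := hA.1.
Let Bs : B^T = B := hB.1.
Local Notation f := (objective A B).
Local Notation s := (anorm A).
Local Notation g := (grad A B).

Definition gd_step (alpha : R) x := x - alpha *: g x.

Lemma dot_psi x : 0 < s x -> dot x (psi A x) = s x.
Proof.
move=> x0; rewrite /psi dotZr -anorm_sqr// expr2 mulKf// gt_eqF//.
Qed.

Lemma dot_grad x : 0 < s x -> dot x (g x) = 2 * dot x (B *m x) - s x.
Proof. by move=> x0; rewrite /grad dotDr dotNr dotZr dot_psi. Qed.

(** Eliminating x' B x between x' g = 2 x' B x - s and f = x' B x - s leaves s alone. *)
Lemma anorm_eq_dot_grad x : 0 < s x -> s x = dot x (g x) - 2 * f x.
Proof. by move=> x0; rewrite dot_grad// objectiveE; ring. Qed.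

(* [-s] lies below its tangents, so [f] lies below a quadratic with Hessian [2 B]. *)
Lemma objective_upper x v : 0 < s x -> f (x + v) <= f x + dot (g x) v + dot v (B *m v).
Proof.
move=> x0; rewrite !objectiveE /grad !dot_linE (dot_sym v x Bs).
have : s x + dot (psi A x) v <= s (x + v).
  rewrite -(ler_pM2l x0) mulrDr -expr2 anorm_sqr// /psi dotZl mulVKf ?gt_eqF//.
  have := anorm_cauchy_schwarz hA x (x + v).
  by rewrite !dot_linE (dot_sym x v As) (dotC v).
rewrite (dotC (B *m x)) (dot_sym v x Bs) /psi dotZl.
lra.
Qed.

Lemma sqr_dot_le x y : dot x y ^+ 2 <= dot x x * dot y y.
Proof.
have := @psd_cauchy_schwarz R n 1%:M x y (trmx1 _ _).
by rewrite !mul1mx; apply => z; rewrite mul1mx dot_ge0.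
Qed.

(** The form of [B] dominates b |x|^2 and s^2 is at most K |x|^2. Young's inequality s <= b s^2 / (2
    K) + K / (2 b) costs half of the quadratic term. *)
Lemma objective_coercive : exists b c : R, 0 < b /\ forall x, b * dot x x - c <= f x.
Proof.
have [b b0 hb] : exists2 b : R, 0 < b & forall x, b * dot x x <= dot x (B *m x).
  by apply: pd_lower_bound => // x /hB.2; rewrite quad_formE.
pose K := n%:R ^+ 2 * `|A| + 1.
have K0 : 0 < K by rewrite ltr_wpDl// !mulr_ge0.
exists (b / 2), (K / (2 * b)); split; first by rewrite divr_gt0.
move=> x; rewrite objectiveE.
have sK : s x ^+ 2 <= K * dot x x.
  rewrite anorm_sqr//; apply: (le_trans (ler_norm _)); apply: (le_trans (norm_quad_le _ _)).
  by rewrite ler_wpM2r ?dot_ge0// lerDl.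
have : s x <= b / (2 * K) * s x ^+ 2 + K / (2 * b).
  rewrite -subr_ge0 (_ : _ - _ = (b * s x - K) ^+ 2 / (2 * K * b)).
    by rewrite divr_ge0 ?sqr_ge0// !mulr_ge0// ltW.
  by field; rewrite !gt_eqF.
have : b / (2 * K) * s x ^+ 2 <= b / 2 * dot x x.
  rewrite (_ : b / 2 * _ = b / (2 * K) * (K * dot x x)); last by field; rewrite gt_eqF.
  by rewrite ler_wpM2l// divr_ge0 ?mulr_ge0// ltW.
by have := hb x; lra.
Qed.

(** With y = A x, Cauchy-Schwarz for [A] gives |y|^4 <= (y' A y) (x' A x) <= K |y|^2 (x' A x). *)
Lemma dot_image_le : exists2 K : R, 0 < K &
  forall x, dot (A *m x) (A *m x) <= K * dot x (A *m x).
Proof.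
pose K := n%:R ^+ 2 * `|A| + 1.
have K0 : 0 < K by rewrite ltr_wpDl// !mulr_ge0.
exists K => // x; set y := A *m x.
have := psd_cauchy_schwarz y x As (psdA hA); rewrite -/y => h.
have yK : dot y (A *m y) <= K * dot y y.
  apply: (le_trans (ler_norm _)); apply: (le_trans (norm_quad_le _ _)).
  by rewrite ler_wpM2r ?dot_ge0// lerDl.
have [->|y0] := eqVneq y 0; first by rewrite !dot0r mulr0.
rewrite -(ler_pM2l (dot_gt0 y0)) -expr2; apply: (le_trans h).
rewrite mulrA (mulrC _ K) ler_wpM2r//; exact: psdA.
Qed.

Variables (L alpha : R).
Hypotheses (hA0 : A != 0) (hL : 0 < L) (hHess : forall x, A *m x != 0 ->
  loewner_le (hessian (objective A B) x) L%:M).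
Hypothesis hal : 0 < alpha < 2 / L.

(** The guaranteed decrease of the objective per unit of |g|^2; it is positive exactly because the
    stepsize lies in (0, 2 / L). *)
Let c := alpha * (1 - alpha * L / 2).

Lemma descent_gt0 : 0 < c.
Proof.
case/andP: hal => a0 aL; rewrite mulr_gt0// subr_gt0 ltr_pdivrMr// mul1r.
by rewrite -ltr_pdivlMr.
Qed.

Lemma descent x : 0 < s x -> f (gd_step alpha x) <= f x - c * dot (g x) (g x).
Proof.
move=> x0; apply: (le_trans (objective_upper _ x0)).
have := B_le hA hB hA0 hHess (g x); move: (g x) => y hy.
rewrite !dot_linE /c.
have : alpha ^+ 2 * (2 * dot y (B *m y)) <= alpha ^+ 2 * (L * dot y y).
  by rewrite ler_wpM2l// sqr_ge0.
by rewrite expr2; lra.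
Qed.

(** * Convergence of a single orbit that avoids the kernel of [A] *)

Section orbit.
Variable x : nat -> 'cV[R]_n.
Hypotheses (xS : forall k, x k.+1 = gd_step alpha (x k)) (xA : forall k, 0 < s (x k)).

Let dg k := dot (g (x k)) (g (x k)).

Lemma orbit_descent k : c * dg k <= f (x k) - f (x k.+1).
Proof. by rewrite xS; have := descent (xA k); rewrite -/(dg k); lra. Qed.

Lemma orbit_nonincreasing k : f (x k.+1) <= f (x k).
Proof.
have := orbit_descent k; have : 0 <= c * dg k by rewrite mulr_ge0 ?dot_ge0// ltW// descent_gt0.
lra.
Qed.

Lemma orbit_cvg_objective : exists2 fs, f (x k) @[k --> \oo] --> fs &
  forall k, fs <= f (x k).
Proof.
have ni : nonincreasing_seq (fun k => f (x k)).
  by apply/nonincreasing_seqP => k; exact: orbit_nonincreasing.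
have cv : cvgn (fun k => f (x k)).
  apply: nonincreasing_is_cvgn => //; have [b [d [b0 h]]] := objective_coercive.
  exists (- d) => _ [k _ <-]; apply: le_trans (h (x k)).
  by rewrite lerBrDr addNr mulr_ge0 ?dot_ge0// ltW.
exists (limn (fun k => f (x k))); first exact: cv.
by move=> k; exact: nonincreasing_cvgn_ge.
Qed.

Lemma orbit_dot_bounded : exists2 D, 0 < D & forall k, dot (x k) (x k) <= D.
Proof.
have [b [d [b0 h]]] := objective_coercive.
exists (`|(f (x 0) + d) / b| + 1); first by rewrite ltr_wpDl.
move=> k; have fk : f (x k) <= f (x 0).
  by elim: k => // k; apply: le_trans; exact: orbit_nonincreasing.
apply: (@le_trans _ _ ((f (x 0) + d) / b)).
  by rewrite ler_pdivlMr// mulrC; have := h (x k); lra.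
by rewrite (le_trans (ler_norm _))// lerDl.
Qed.

Lemma orbit_grad_cvg0 : dg k @[k --> \oo] --> 0.
Proof.
have [fs ffs _] := orbit_cvg_objective; have c0 := descent_gt0.
apply/cvgrPdist_le => e e0.
(* Two consecutive objective values within c e / 2 of the limit differ by at most c e, which bounds
   c |g|^2. *)
have ce : 0 < c * e / 2 by rewrite divr_gt0 ?(mulr_gt0 c0).
move/cvgrPdist_le : ffs => /(_ _ ce)[N _ hN]; exists N => // k /= Nk.
have hk := hN _ Nk; have hk1 := hN k.+1 (leqW Nk); rewrite /= in hk hk1.
rewrite sub0r normrN ger0_norm ?dot_ge0// -(ler_pM2l c0).
apply: (le_trans (orbit_descent k)).
move: hk hk1; rewrite !ler_norml => /andP[? ?] /andP[? ?].
lra.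
Qed.

Lemma orbit_dot_grad_cvg0 : dot (x k) (g (x k)) @[k --> \oo] --> 0.
Proof.
have [D D0 hD] := orbit_dot_bounded.
apply/cvgrPdist_le => e e0.
move/cvgrPdist_le : orbit_grad_cvg0 => /(_ (e ^+ 2 / D)).
rewrite divr_gt0 ?exprn_gt0// => /(_ isT); apply: filterS => k.
rewrite !sub0r !normrN ger0_norm ?dot_ge0// => h.
rewrite -(@ler_pXn2r _ 2) ?nnegrE ?normr_ge0 ?(ltW e0)// real_normK ?num_real//.
apply: (le_trans (sqr_dot_le _ _)).
have -> : e ^+ 2 = D * (e ^+ 2 / D) by field; rewrite gt_eqF.
by rewrite ler_pM ?dot_ge0.
Qed.

(** In s = x' g - 2 f the first term tends to 0. Hence sb = -2 f*, where f* is the limit of the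
    objective values and bounds them from below. *)
Lemma orbit_anorm_cvg : exists sb, [/\ s (x k) @[k --> \oo] --> sb, 0 <= sb &
  forall k, - (sb / 2) <= f (x k)].
Proof.
have [fs ffs lef] := orbit_cvg_objective.
have cv : s (x k) @[k --> \oo] --> - 2 * fs.
  have -> : (fun k => s (x k)) = (fun k => dot (x k) (g (x k)) + (- 2) * f (x k)).
    by apply/funext => k; rewrite {1}anorm_eq_dot_grad// mulNr.
  rewrite -[X in _ --> X]add0r; apply: cvgD; first exact: orbit_dot_grad_cvg0.
  by apply: cvgM => //; exact: cvg_cst.
exists (- 2 * fs); split => //.
  have -> : - 2 * fs = limn (fun k => s (x k)) by apply/esym/cvg_lim.
  apply: limr_ge; first by apply/cvg_ex; exists (- 2 * fs).
  by apply: nearW => k; exact: anorm_ge0.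
by move=> k; rewrite (_ : - _ = fs) //; field.
Qed.

(* Otherwise [x_k -> 0] and [psi = 2 B x - g -> 0], but [psi] is bounded away from 0. *)
Lemma orbit_anorm_lim_gt0 sb : s (x k) @[k --> \oo] --> sb -> 0 <= sb -> 0 < sb.
Proof.
move=> scv; rewrite le_eqVlt => /orP[/eqP sb0|//]; exfalso; rewrite -{}sb0 in scv.
have [C C0 hC] := quad_le_sqr_image As.
(* [A] is bounded below on its range: s^2 = x' A x <= C |A x|^2. *)
have psiC k : 1 <= C * dot (psi A (x k)) (psi A (x k)).
  rewrite /psi dotZl dotZr.
  have -> : C * ((s (x k))^-1 * ((s (x k))^-1 * dot (A *m x k) (A *m x k))) =
      C * dot (A *m x k) (A *m x k) / s (x k) ^+ 2.
    by field; rewrite gt_eqF.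
  rewrite ler_pdivlMr ?exprn_gt0// mul1r anorm_sqr//.
  by apply: le_trans (hC _); exact: ler_norm.
have [b b0 hb] : exists2 b : R, 0 < b & forall x, b * dot x x <= dot x (B *m x).
  by apply: pd_lower_bound => // y /hB.2; rewrite quad_formE.
pose K := n%:R ^+ 2 * `|B *m B|.
have K0 : 0 <= K by rewrite !mulr_ge0.
have hK y : dot (B *m y) (B *m y) <= K * dot y y.
  have -> : dot (B *m y) (B *m y) = dot y ((B *m B) *m y).
    by rewrite -mulmxA [RHS]dot_mulmxr Bs.
  by apply: (le_trans (ler_norm _)); exact: norm_quad_le.
(* Here psi = 2 B x - g, |B x|^2 <= (K / b) x' B x and 2 x' B x = x' g + s. *)
have upper k : dot (psi A (x k)) (psi A (x k)) <=
    4 * K / b * (dot (x k) (g (x k)) + s (x k)) + 2 * dg k.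
  have -> : psi A (x k) = 2 *: (B *m x k) - g (x k).
    by rewrite /grad opprB addrC subrK.
  set y := B *m x k; set h := g (x k).
  apply: (le_trans (dot_subr_le _ _)); rewrite lerD// dotZl dotZr.
  rewrite dot_grad// subrK.
  have -> : 4 * K / b * (2 * dot (x k) (B *m x k)) = 8 * K * (dot (x k) (B *m x k) / b).
    by field; rewrite gt_eqF.
  have h2 := hK (x k); rewrite -/y in h2.
  have h3 : dot (x k) (x k) <= dot (x k) (B *m x k) / b by rewrite ler_pdivlMr// mulrC.
  have : K * dot (x k) (x k) <= K * (dot (x k) (B *m x k) / b) by rewrite ler_wpM2l.
  lra.
have : C * (4 * K / b * (dot (x k) (g (x k)) + s (x k)) + 2 * dg k)
    @[k --> \oo] --> C * (4 * K / b * (0 + 0) + 2 * 0).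
  apply: cvgM; first exact: cvg_cst.
  apply: cvgD; (apply: cvgM; first exact: cvg_cst).
    by apply: cvgD => //; exact: orbit_dot_grad_cvg0.
  exact: orbit_grad_cvg0.
rewrite addr0 !mulr0 addr0 mulr0 => /cvgrPdist_le/(_ (1 / 2)).
rewrite divr_gt0// => /(_ isT)[N _ /(_ N (leqnn N))] /=.
rewrite sub0r normrN ler_norml => /andP[_]; apply/negP; rewrite -ltNge.
have := upper N; rewrite -(ler_pM2l C0) => up.
by have := le_trans (psiC N) up; lra.
Qed.

(* With [H = 2 B - A / sb] one has [f - f* = x' H x / 2 + (s - sb)^2 / (2 sb)] and
   [x' g = x' H x + s (s - sb) / sb], while [|x' H x| <= C |H x|^2]. *)
Lemma orbit_lojasiewicz sb : s (x k) @[k --> \oo] --> sb -> 0 < sb ->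
  exists2 C : R, 0 < C & \forall k \near \oo, f (x k) + sb / 2 <= C * dg k.
Proof.
move=> scv sb0; pose H := 2 *: B - sb^-1 *: A.
have Hs : H^T = H by rewrite /H linearB /= !linearZ /= As Bs.
have [C C0 hC] := quad_le_sqr_image Hs.
have [K K0 hK] := dot_image_le.
have [D D0 hD] := orbit_dot_bounded.
pose P := D + 1 + 2 * C.
have P0 : 0 < P by rewrite !addr_gt0// mulr_gt0.
(* With p = s - sb, the first bound gives s >= sb / 2, hence s |p| / sb >= |p| / 2. The second keeps
   the term of order p^2 in C |H x|^2 below |p| / 4. *)
pose d := Num.min (sb / 2) (sb ^+ 2 / (8 * C * K)).
have d0 : 0 < d by rewrite lt_min !divr_gt0// ?exprn_gt0// !mulr_gt0.
exists (C + (C * K / sb ^+ 2 + (2 * sb)^-1) * (16 * P ^+ 2) + 1).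
  rewrite ltr_wpDl// addr_ge0 ?(ltW C0)// mulr_ge0//.
    by rewrite addr_ge0// ?invr_ge0 ?divr_ge0 ?mulr_ge0 ?exprn_ge0 ?(ltW C0, ltW K0, ltW sb0).
  by rewrite mulr_ge0// exprn_ge0// ltW.
move/cvgrPdist_le : scv => /(_ _ d0).
move/cvgrPdist_le : orbit_grad_cvg0 => /(_ _ ltr01).
apply: filterS2 => k; rewrite sub0r normrN ger0_norm ?dot_ge0// => dg1.
rewrite distrC le_min.
have sk := xA k; set sx := s (x k) in sk *; set p := sx - sb => /andP[p1 p2].
set y := H *m x k.
have gE : g (x k) = y + (p / (sx * sb)) *: (A *m x k).
  rewrite /grad /psi /y /H mulmxBl -!scalemxAl -addrA; congr (_ + _).
  rewrite -!scaleNr -scalerDl; congr (_ *: _); rewrite -/sx /p; field.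
  by rewrite !gt_eqF.
have yE : y = g (x k) - (p / (sx * sb)) *: (A *m x k) by rewrite gE addrK.
have sx2 : dot (x k) (A *m x k) = sx ^+ 2 by rewrite -anorm_sqr.
have ax2 : dot (A *m x k) (A *m x k) <= K * sx ^+ 2 by rewrite -sx2.
have yy : dot y y <= 2 * dg k + 2 * K / sb ^+ 2 * p ^+ 2.
  set z := (p / (sx * sb)) *: (A *m x k) in yE.
  have : dot z z <= K / sb ^+ 2 * p ^+ 2.
    rewrite /z dotZl dotZr mulrA -expr2.
    have -> : K / sb ^+ 2 * p ^+ 2 = (p / (sx * sb)) ^+ 2 * (K * sx ^+ 2).
      by field; rewrite !gt_eqF.
    by rewrite ler_wpM2l// sqr_ge0.
  have : dot y y <= 2 * dg k + 2 * dot z z.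
    by rewrite yE; exact: dot_subr_le.
  lra.
have dg0 : 0 <= dg k := dot_ge0 _.
have pp : p ^+ 2 = `|p| ^+ 2 by rewrite real_normK// num_real.
have xy : `|dot (x k) y| <= C * (2 * dg k + 2 * K / sb ^+ 2 * p ^+ 2).
  by apply: (le_trans (hC _)); rewrite ler_pM2l.
have xg : dot (x k) (g (x k)) = dot (x k) y + sx * p / sb.
  rewrite gE dotDr dotZr sx2; congr (_ + _); field.
  by rewrite !gt_eqF.
have gam : `|dot (x k) (g (x k))| <= (D + 1) * Num.sqrt (dg k).
  rewrite -(@ler_pXn2r _ 2) ?nnegrE ?normr_ge0 ?mulr_ge0 ?sqrtr_ge0 ?addr_ge0 ?(ltW D0)//.
  rewrite real_normK ?num_real// exprMn sqr_sqrtr//.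
  apply: (le_trans (sqr_dot_le _ _)); rewrite ler_wpM2r//.
  by apply: (le_trans (hD k)); rewrite expr2; nra.
set gm := Num.sqrt (dg k) in gam.
have gm0 : 0 <= gm := sqrtr_ge0 _.
have gm2 : dg k = gm ^+ 2 by rewrite sqr_sqrtr.
have gm1 : gm <= 1.
  by rewrite -(@ler_pXn2r _ 2) ?nnegrE// -gm2 expr1n.
have half : `|p| / 2 <= sx * `|p| / sb.
  rewrite ler_pdivlMr// -mulrA (mulrC sx) ler_wpM2l//.
  by move: p1; rewrite ler_norml /p => /andP[]; lra.
have small : C * (2 * K / sb ^+ 2 * p ^+ 2) <= `|p| / 4.
  rewrite pp expr2.
  have -> : C * (2 * K / sb ^+ 2 * (`|p| * `|p|)) = `|p| * (2 * C * K / sb ^+ 2 * `|p|).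
    by ring.
  rewrite ler_wpM2l//.
  have -> : 4^-1 = 2 * C * K / sb ^+ 2 * (sb ^+ 2 / (8 * C * K)) :> R.
    by field; rewrite !gt_eqF.
  by rewrite ler_wpM2l// divr_ge0 ?exprn_ge0 ?(ltW sb0)// !mulr_ge0 ?(ltW C0) ?(ltW K0).
(* In x' g = x' H x + s p / sb the last term is at least |p| / 2 in absolute value. A quarter of |p|
   absorbs part of x' H x, and what remains is at most P |g|. *)
have pg : `|p| <= 4 * P * gm.
  have : sx * `|p| / sb = `|dot (x k) (g (x k)) - dot (x k) y|.
    by rewrite xg addrC addKr !normrM normfV (gtr0_norm sk) (gtr0_norm sb0).
  have := ler_normB (dot (x k) (g (x k))) (dot (x k) y).
  have : C * (2 * dg k) <= 2 * C * gm.
    rewrite mulrA (mulrC C) ler_wpM2l ?mulr_ge0 ?(ltW C0)// gm2 expr2.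
    by rewrite -[leRHS]mulr1 ler_wpM2l.
  by rewrite /P; nra.
have p2g : p ^+ 2 <= 16 * P ^+ 2 * dg k.
  rewrite pp gm2 (_ : 16 * P ^+ 2 * gm ^+ 2 = (4 * P * gm) ^+ 2); last by ring.
  by rewrite lerXn2r ?nnegrE// !mulr_ge0// ltW.
have fE : f (x k) + sb / 2 = dot (x k) y / 2 + p ^+ 2 / (2 * sb).
  rewrite objectiveE -/sx /y /H mulmxBl -!scalemxAl dotDr dotNr !dotZr sx2 /p.
  by field; rewrite gt_eqF.
rewrite fE.
have e1 : dot (x k) y / 2 <= C * dg k + C * K / sb ^+ 2 * p ^+ 2.
  have := ler_norm (dot (x k) y); have := xy.
  have -> : C * (2 * dg k + 2 * K / sb ^+ 2 * p ^+ 2) =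
    2 * (C * dg k + C * K / sb ^+ 2 * p ^+ 2) by ring.
  lra.
have e2 : (C * K / sb ^+ 2 + (2 * sb)^-1) * p ^+ 2 <=
    (C * K / sb ^+ 2 + (2 * sb)^-1) * (16 * P ^+ 2 * dg k).
  rewrite ler_wpM2l// addr_ge0// ?invr_ge0 ?divr_ge0 ?mulr_ge0 ?exprn_ge0//; exact: ltW.
lra.
Qed.

Lemma orbit_cvg_critical : exists l, [/\ x k @[k --> \oo] --> l, 0 < s l & g l = 0].
Proof.
have [sb [scv sb0 lef]] := orbit_anorm_cvg.
have {}sb0 := orbit_anorm_lim_gt0 scv sb0.
have [C C0 [N _ hN]] := orbit_lojasiewicz scv sb0.
have c0 := descent_gt0.
pose e k := f (x k) + sb / 2.
have e0 k : 0 <= e k by have := lef k; rewrite /e; lra.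
(* From e_k <= C |g|^2 and c |g|^2 <= e_k - e_(k+1) follows (C + c) e_(k+1) <= C e_k. The increments
   alpha |g| are then at most alpha sqrt (e_k / c), which decays geometrically. *)
pose q := C / (C + c).
have q0 : 0 <= q by rewrite divr_ge0 ?addr_ge0// ltW.
have q1 : q < 1 by rewrite ltr_pdivrMr ?addr_gt0// mul1r ltrDl.
have eS k : (N <= k)%N -> e k.+1 <= q * e k.
  move=> /hN /= ek; have := orbit_descent k; rewrite -/(e k) in ek.
  have -> : f (x k) - f (x k.+1) = e k - e k.+1 by rewrite /e; ring.
  move=> h; rewrite /q mulrAC ler_pdivlMr ?addr_gt0//.
  have h0 : 0 <= c * (c * dg k) by rewrite !(mulr_ge0 (ltW c0))// dot_ge0.
  have h1 : c * (c * dg k) <= c * (e k - e k.+1) by rewrite ler_pM2l.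
  have h2 : c * e k <= c * (C * dg k) by rewrite ler_pM2l.
  have h3 : C * (c * dg k) <= C * (e k - e k.+1) by rewrite ler_pM2l.
  lra.
have eq j : e (N + j)%N <= e N * q ^+ j.
  elim: j => [|j IH]; first by rewrite addn0 expr0 mulr1.
  rewrite addnS; apply: (le_trans (eS _ (leq_addr _ _))).
  by rewrite exprS mulrCA ler_wpM2l.
have inc j : `|x (N + j).+1 - x (N + j)%N| <= (alpha * Num.sqrt (e N / c)) * (Num.sqrt q) ^+ j.
  case/andP: hal => a0 _.
  rewrite xS /gd_step addrAC subrr add0r normrN normrZ gtr0_norm// -mulrA ler_pM2l//.
  rewrite -(@ler_pXn2r _ 2) ?nnegrE ?mulr_ge0 ?exprn_ge0 ?sqrtr_ge0//.
  apply: (le_trans (sqr_norm_le_dot _)); rewrite exprMn sqr_sqrtr ?divr_ge0 ?(ltW c0)//.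
  rewrite -exprM mulnC exprM sqr_sqrtr// mulrAC ler_pdivlMr// mulrC.
  apply: le_trans (eq j); apply: (le_trans (orbit_descent _)).
  by have := e0 (N + j).+1; rewrite /e; lra.
have sq1 : 0 <= Num.sqrt q < 1.
  by rewrite sqrtr_ge0 -[X in _ < X]sqrtr1 ltr_sqrt.
have [l xl] := geometric_increments_cvg_col sq1 inc.
have lid (u v : 'cV[R]_n) : `|u - v| <= 1 * `|u - v| by rewrite mul1r.
(* The square of s is used here: it is locally Lipschitz everywhere, whereas [loclip_anorm]
   presupposes that s is positive at the limit. *)
have sl : 0 < s l.
  rewrite sqrtr_gt0.
  have ld : loclip (fun u => dot u (A *m u)) l.
    under eq_fun do rewrite dotE; apply: loclip_sum => j.
    by apply: loclip_mul; [exact: (loclip_entry _ lid)|exact: (loclip_mulmx _ lid)].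
  have /cvg_lim <- // := loclip_cvg xl ld.
  under eq_fun do rewrite -anorm_sqr//.
  have -> : limn (fun k => s (x k) ^+ 2) = sb ^+ 2.
    by apply/cvg_lim => //; under eq_fun do rewrite expr2; exact: cvgM.
  by rewrite exprn_gt0.
exists l; split => //; apply/colP => i; rewrite [RHS]mxE.
have lg := @loclip_grad R n A B _ _ _ _ i lid sl.
have /cvg_lim <- // := loclip_cvg xl lg.
apply/cvg_lim => //; apply/cvgrPdist_le => eps eps0.
move/cvgrPdist_le : orbit_grad_cvg0 => /(_ (eps ^+ 2)).
rewrite exprn_gt0// => /(_ isT); apply: filterS => k.
rewrite !sub0r !normrN ger0_norm ?dot_ge0// => h.
apply: (le_trans (ler_mx_norm_entry _ _ _)).
rewrite -(@ler_pXn2r _ 2) ?nnegrE ?(ltW eps0)//.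
exact: (le_trans (sqr_norm_le_dot _)).
Qed.

End orbit.
End descent.

(** * Saddle avoidance *)

Section critical_points.
Variables (R : realType) (n : nat) (A B : 'M[R]_n).
Hypotheses (hA : psdmx A) (hB : pdmx B).
Implicit Types x y u v : 'cV[R]_n.

Let As : A^T = A := hA.1.
Let Bs : B^T = B := hB.1.
Local Notation f := (objective A B).
Local Notation s := (anorm A).
Local Notation g := (grad A B).

(* With [H = 2 B - A / s l], a direction of negative curvature of [H] can be made
   A-orthogonal to [l] without changing [v' H v], since [H l = 0]. *)
Lemma critical_min_or_saddle l : 0 < s l -> g l = 0 ->
  (forall y, f l <= f y) \/ exists v, dot v (hess A B l *m v) < 0.
Proof.
move=> sl gl; set sb := s l in sl; pose H := 2 *: B - sb^-1 *: A.
have Hs : H^T = H by rewrite /H linearB /= !linearZ /= As Bs.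
have Hl : H *m l = 0 by rewrite -gl /grad /psi /H mulmxBl -!scalemxAl.
have [pos|neg] := pselect (forall v, 0 <= dot v (H *m v)).
  left => y; have sb0 : sb != 0 by rewrite gt_eqF.
  have fl : f l = - (sb / 2).
    by have := anorm_eq_dot_grad B hA sl; rewrite gl dot0r -/sb; lra.
  have fy : f y = dot y (H *m y) / 2 + (s y - sb) ^+ 2 / (2 * sb) - sb / 2.
    rewrite objectiveE /H mulmxBl -!scalemxAl dotDr dotNr !dotZr -(anorm_sqr hA y).
    by field.
  rewrite fl fy; have := pos y.
  have : 0 <= (s y - sb) ^+ 2 / (2 * sb) by rewrite divr_ge0 ?sqr_ge0// mulr_ge0// ltW.
  lra.
right; have [v vneg] : exists v, dot v (H *m v) < 0.
  apply: contrapT => no; apply: neg => v; rewrite leNgt; apply/negP => vn.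
  by apply: no; exists v.
pose w := v - (dot (A *m l) v / sb ^+ 2) *: l.
have Aw : dot (A *m l) w = 0.
  have Al : dot (A *m l) l = sb ^+ 2 by rewrite dotC -(anorm_sqr hA).
  by rewrite /w dotDr dotNr dotZr Al divfK ?subrr// expf_neq0// gt_eqF.
have wH : dot w (H *m w) = dot v (H *m v).
  rewrite /w mulmxBr -scalemxAr Hl scaler0 subr0 dotDl dotNl dotZl.
  by rewrite (dot_sym l v Hs) Hl dot0r mulr0 subr0.
exists w; rewrite /hess /psi_slope -/sb opprB addrC -addrA (addrC (- _)) -/H.
rewrite mulmxDl dotDr wH -scalemxAl dotZr outer_mulmx (mulmxDr A l l)
  (dotDl (A *m l)) Aw addr0.
by rewrite scale0r dot0r mulr0 add0r.
Qed.

End critical_points.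

(** * Invertible shifts of a symmetric matrix *)

Section regular_shift.
Variables (R : realType) (n : nat).

(** A singular shift makes t a root of the characteristic polynomial of -M, of degree n; the n + 1
    distinct points e / (i + 2) of (0, e) cannot all be roots. *)
Lemma exists_unitmx_shift (M : 'M[R]_n) e : M^T = M -> 0 < e ->
  exists t, 0 < t < e /\ M + t%:M \in unitmx.
Proof.
move=> Ms e0; apply: contrapT => no.
have root t : 0 < t < e -> root (char_poly (- M)) t.
  move=> te; rewrite -eigenvalue_root_char; apply: contrapT => ne; apply: no.
  exists t; split => //; apply: unitmx_inj => x.
  rewrite mulmxDl mul_scalar_mx => /eqP; rewrite addr_eq0 => /eqP Mx.
  apply: contrapT => /eqP x0; apply: ne; apply/eigenvalueP; exists x^T.
    rewrite mulmxN -{1}Ms -trmx_mul Mx linearN /= linearZ /= opprK //.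
  by apply: contra x0 => /eqP xt0; rewrite -[x]trmxK xt0 trmx0.
have := @max_poly_roots _ _ [seq e / i.+2%:R | i <- iota 0 n.+1]
  (monic_neq0 (char_poly_monic (- M))).
rewrite size_char_poly size_map size_iota ltnn.
move=> h; suff : false by []; apply: h.
  apply/allP => _ /mapP[i _ ->]; apply: root.
  by rewrite divr_gt0// ltr_pdivrMr// ltr_pMr// ltr1n.
rewrite map_inj_uniq ?iota_uniq// => i j /(mulfI (lt0r_neq0 e0))/invr_inj/eqP.
by rewrite eqr_nat !eqSS => /eqP.
Qed.

End regular_shift.

(** * The gradient map in (point, stepsize) space *)

Section gradient_map.
Variables (R : realType) (n : nat) (A B : 'M[R]_n).
Hypotheses (hA : psdmx A) (hB : pdmx B).
Local Notation V := ('cV[R]_n * R)%type.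
Implicit Types (x y u v : 'cV[R]_n) (w : V).

Let As : A^T = A := hA.1.
Let Bs : B^T = B := hB.1.
Local Notation s := (anorm A).
Local Notation g := (grad A B).

(* The stepsize is carried along as a coordinate, so that a.e. statements in
   (point, stepsize) concern a single map. *)
Definition gd_map w : V := (gd_step A B w.2 w.1, w.2).

(** The exact slope between two points of the gradient step with stepsize a; at y = x it is the
    Jacobian 1 - a [hess]. *)
Definition gd_slope (a : R) x y : 'M[R]_n := 1%:M - a *: (2 *: B - psi_slope A x y).

Lemma gd_step_sub (a b : R) x y : 0 < s x -> 0 < s y ->
  gd_step A B a x - gd_step A B b y = gd_slope a x y *m (x - y) - (a - b) *: g y.
Proof.
move=> sx sy.
have gxy : g x - g y = (2 *: B - psi_slope A x y) *m (x - y).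
  by rewrite /grad opprD addrACA -opprD psi_slopeP// [RHS]mulmxBl
    -(scalemxAl 2 B) (mulmxBr B) scalerBr.
rewrite /gd_slope mulmxBl mul1mx -(scalemxAl a) -gxy /gd_step scalerBr scalerBl.
by apply/matrixP => i j; rewrite !mxE; ring.
Qed.

Lemma loclip_near (X : normedModType R) (f : X -> R) a e : loclip f a -> 0 < e ->
  \forall u \near a, `|f u - f a| <= e.
Proof.
move=> lf e0; have [r r0 h] := loclip_cont lf e0.
apply/nbhs_normP; exists r => //= u; rewrite /= distrC => /ltW; exact: h.
Qed.

Lemma near_closed_ball (X : normedModType R) (P : X -> Prop) a :
  (\forall p \near a, P p) -> exists2 r, 0 < r & forall p, `|p - a| <= r -> P p.
Proof.
move=> /nbhs_normP[r /= r0 hr]; exists (r / 2); first by rewrite divr_gt0.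
move=> p pr; apply: hr; rewrite /= distrC; apply: (le_lt_trans pr).
by rewrite ltr_pdivrMr// ltr_pMr// ltr1n.
Qed.

Lemma ler_norm_fst (U W : normedModType R) (p q : U * W) : `|p.1 - q.1| <= `|p - q|.
Proof. by rewrite [leRHS]prod_normE le_max lexx. Qed.

Lemma ler_norm_snd (U W : normedModType R) (p q : U * W) : `|p.2 - q.2| <= `|p - q|.
Proof. by rewrite [leRHS]prod_normE le_max lexx orbT. Qed.

Lemma gd_slope_near (xb : 'cV[R]_n) (ab : R) e : 0 < s xb -> 0 < e -> exists2 r, 0 < r &
  forall w w', `|w - (xb, ab)| <= r -> `|w' - (xb, ab)| <= r ->
  [/\ 0 < s w.1, `|gd_slope w.2 w.1 w'.1 - gd_slope ab xb xb| <= e &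
      `|g w'.1 - g xb| <= e].
Proof.
move=> sb e0; pose wb : V := (xb, ab); pose wwb : V * V := (wb, wb).
have l11 (p q : V * V) : `|p.1.1 - q.1.1| <= 1 * `|p - q|.
  by rewrite mul1r; exact: le_trans (ler_norm_fst _ _) (ler_norm_fst _ _).
have l12 (p q : V * V) : `|p.1.2 - q.1.2| <= 1 * `|p - q|.
  by rewrite mul1r; exact: le_trans (ler_norm_snd _ _) (ler_norm_fst _ _).
have l21 (p q : V * V) : `|p.2.1 - q.2.1| <= 1 * `|p - q|.
  by rewrite mul1r; exact: le_trans (ler_norm_fst _ _) (ler_norm_snd _ _).
have n1 : \forall p \near wwb, 0 < s p.1.1.
  have ls : loclip (fun p : V * V => s p.1.1) wwb by apply: (loclip_anorm l11).
  have [r r0 h] := loclip_pos ls sb.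
  apply/nbhs_normP; exists r => //= p; rewrite /= distrC => /ltW/h.
  by apply: lt_le_trans; rewrite divr_gt0.
have n2 : \forall p \near wwb, forall ij : 'I_n * 'I_n,
    `|gd_slope p.1.2 p.1.1 p.2.1 ij.1 ij.2 - gd_slope ab xb xb ij.1 ij.2| <= e.
  apply: (@filter_forall _ _ _ (nbhs wwb)) => -[i j].
  have E a x y : gd_slope a x y i j =
      (1%:M : 'M[R]_n) i j - a * (2 * B i j - psi_slope A x y i j).
    by rewrite mxE [X in _ + X]mxE [X in _ - X]mxE [X in _ - _ * X]mxE [X in _ - _ * (X + _)]mxE
      [X in _ - _ * (_ + X)]mxE.
  have lf : loclip (fun p : V * V => gd_slope p.1.2 p.1.1 p.2.1 i j) wwb.
    under eq_fun do rewrite E.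
    apply: loclip_add; first exact: loclip_cst.
    apply: loclip_opp; apply: loclip_mul; first exact: (@loclip_lip _ _ 1).
    apply: loclip_add; first exact: loclip_cst.
    by apply: loclip_opp; apply: (loclip_psi_slope _ _ l11 l21).
  exact: (loclip_near lf e0).
have n3 : \forall p \near wwb, forall i, `|g p.2.1 i 0 - g xb i 0| <= e.
  apply: (@filter_forall _ _ _ (nbhs wwb)) => i.
  have lg : loclip (fun p : V * V => g p.2.1 i 0) wwb by apply: (loclip_grad _ _ l21).
  exact: (loclip_near lg e0).
have [r1 r10 h1] := near_closed_ball n1.
have [r2 r20 h2] := near_closed_ball n2.
have [r3 r30 h3] := near_closed_ball n3.
exists (Num.min r1 (Num.min r2 r3)); first by rewrite !lt_min r10 r20.
move=> w w'; rewrite !le_min => /andP[w1 /andP[w2 w3]] /andP[w1' /andP[w2' w3']].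
have nn r : `|w - wb| <= r -> `|w' - wb| <= r -> `|(w, w') - wwb| <= r.
  by move=> ? ?; rewrite prod_normE ge_max; apply/andP.
split.
- exact: (h1 (w, w') (nn _ w1 w1')).
- apply/mx_norm_leP; first exact: ltW.
  move=> i j; have -> (M N : 'M[R]_n) : (M - N) i j = M i j - N i j by rewrite !mxE.
  exact: (h2 (w, w') (nn _ w2 w2') (i, j)).
- apply/mx_norm_leP; first exact: ltW.
  move=> i j; rewrite ord1.
  have -> (M N : 'cV[R]_n) : (M - N) i 0 = M i 0 - N i 0 by rewrite !mxE.
  exact: (h3 (w, w') (nn _ w3 w3') i).
Qed.

(** A quantitative inverse function argument: the slope between nearby points is a small
    perturbation of the invertible [J]. The choice of [e] makes its contribution, after applying
    J^-1, at most half of |dx|, which the left side absorbs. *)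
Lemma gd_map_local_inverse xb ab : 0 < s xb -> gd_slope ab xb xb \in unitmx ->
  exists r C : R, 0 < r /\ forall w w', `|w - (xb, ab)| <= r -> `|w' - (xb, ab)| <= r ->
    `|w - w'| <= C * `|gd_map w - gd_map w'|.
Proof.
move=> sb Ju; set J := gd_slope ab xb xb in Ju.
pose K := n%:R * `|invmx J|; have K0 : 0 <= K by rewrite mulr_ge0.
pose e := (2 * (K * n%:R + 1))^-1.
have Kn : 0 < K * n%:R + 1 by rewrite ltr_wpDl// mulr_ge0.
have e0 : 0 < e by rewrite invr_gt0 mulr_gt0.
have [r r0 h] := gd_slope_near ab sb e0.
pose M := `|g xb| + e.
have M0 : 0 <= M by rewrite addr_ge0// ltW.
exists r, (2 * K * (1 + M) + 1); split => // w w' wr wr'.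
have [sw Jw gw] := h _ _ wr wr'; have [sw' _ _] := h _ _ wr' wr.
set dw := `|gd_map w - gd_map w'|; set dx := w.1 - w'.1; set da := w.2 - w'.2.
have /pair_norm_leP[/= d1 d2] : `|gd_map w - gd_map w'| <= dw by [].
rewrite -/da in d2.
have gM : `|g w'.1| <= M.
  by have := ler_normD (g w'.1 - g xb) (g xb); rewrite subrK /M; lra.
have Jdx : J *m dx = (gd_step A B w.2 w.1 - gd_step A B w'.2 w'.1) -
    (gd_slope w.2 w.1 w'.1 - J) *m dx + da *: g w'.1.
  rewrite gd_step_sub// (mulmxBl (gd_slope w.2 w.1 w'.1) J) -/dx -/da.
  move: (J *m dx) (gd_slope w.2 w.1 w'.1 *m dx) (da *: g w'.1) => p q o.
  by apply/matrixP => i j; rewrite !mxE; ring.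
have nJ : `|J *m dx| <= dw + n%:R * (e * `|dx|) + dw * M.
  rewrite Jdx; apply: (le_trans (ler_normD _ _)); apply: lerD.
    apply: (le_trans (ler_normB _ _)); apply: lerD => //.
    apply: (le_trans (norm_mulmx_le _ _)); rewrite ler_wpM2l//.
    by rewrite ler_wpM2r.
  by rewrite normrZ ler_pM.
have : `|dx| <= K * `|J *m dx|.
  rewrite -{1}[dx]mul1mx -(mulVmx Ju) -mulmxA /K -mulrA.
  exact: norm_mulmx_le.
have Ke : K * (n%:R * (e * `|dx|)) <= `|dx| / 2.
  have -> : `|dx| / 2 = (K * n%:R + 1) * (e * `|dx|) by rewrite /e; field; rewrite gt_eqF.
  have ed : 0 <= e * `|dx| by rewrite mulr_ge0// ltW.
  move: ed; lra.
have KJ : K * `|J *m dx| <= K * (dw + n%:R * (e * `|dx|) + dw * M) by rewrite ler_wpM2l.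
move=> dK.
have dw0 : 0 <= dw := normr_ge0 _.
have dxw : `|dx| <= 2 * K * (1 + M) * dw by lra.
apply/pair_norm_leP; split => /=; rewrite mulrDl mul1r.
  by apply: (le_trans dxw); rewrite lerDl.
by apply: (le_trans d2); rewrite lerDr !mulr_ge0// addr_ge0.
Qed.

(* [Q w = - w' (hess + t) w] satisfies
   [Q (J w) = rho^2 Q w + a (2 rho |K w|^2 - a (K w)' K (K w))] for [K = hess + t],
   [J = 1 - a hess = rho - a K] and [rho = 1 + a t]. *)
Lemma unstable_form xb ab L : 0 < L -> 0 < ab < 2 / L ->
  (forall u, dot u (hess A B xb *m u) <= L * dot u u) ->
  forall v, dot v (hess A B xb *m v) < 0 -> exists K : 'M[R]_n, exists rho2 c : R,
  [/\ K^T = K, dot v (K *m v) < 0, 1 < rho2, 0 < c & forall u,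
    dot (gd_slope ab xb xb *m u) (K *m (gd_slope ab xb xb *m u)) <=
    rho2 * dot u (K *m u) - c * dot u u].
Proof.
move=> L0 /andP[a0 aL] hL v; rewrite /gd_slope -/(hess A B xb).
have := hess_tr hA hB xb; move: (hess A B xb) hL => h hL hs vneg.
have v0 : 0 < dot v v.
  by apply: dot_gt0; apply/eqP => v0; rewrite v0 dot0l ltxx in vneg.
have [|t [/andP[t0 tv] Ku]] := @exists_unitmx_shift R n h (- dot v (h *m v) / dot v v) hs.
  by rewrite divr_gt0// oppr_gt0.
set K := h + t%:M in Ku.
have Ks : K^T = K by rewrite /K linearD /= hs tr_scalar_mx.
pose P := n%:R ^+ 2 * `|(invmx K)^T *m invmx K| + 1.
have P0 : 0 < P by rewrite ltr_wpDl// !mulr_ge0.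
have uK u : dot u u <= P * dot (K *m u) (K *m u).
  have E : u = invmx K *m (K *m u) by rewrite mulmxA mulVmx// mul1mx.
  move: (K *m u) E => y ->; rewrite dot_mulmxr dotC mulmxA.
  apply: (le_trans (ler_norm _)); apply: (le_trans (norm_quad_le _ _)).
  by rewrite ler_wpM2r ?dot_ge0// lerDl.
have aL2 : 0 < 2 - ab * L by rewrite subr_gt0 -ltr_pdivlMr.
pose rho := 1 + ab * t.
exists K, (rho ^+ 2), (ab * (2 - ab * L) / P); split => //.
- rewrite /K mulmxDl mul_scalar_mx dotDr dotZr.
  by move: tv; rewrite ltr_pdivlMr//; lra.
- by rewrite exprn_egt1// ltrDl mulr_gt0.
- by rewrite divr_gt0// mulr_gt0.
move=> u.
have Ju : (1%:M - ab *: h) *m u = rho *: u - ab *: (K *m u).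
  rewrite /K /rho mulmxBl mul1mx -scalemxAl mulmxDl mul_scalar_mx.
  by rewrite scalerDr scalerDl scale1r scalerA opprD addrA addrAC addrK.
have KE y : dot y (K *m y) = dot y (h *m y) + t * dot y y.
  by rewrite /K mulmxDl mul_scalar_mx dotDr dotZr.
have uKK : dot u (K *m (K *m u)) = dot (K *m u) (K *m u) by rewrite dot_mulmxr Ks.
rewrite {}Ju mulmxBr -!scalemxAr.
have Ky := KE (K *m u); have hy := hL (K *m u); have := uK u.
move: uKK Ky hy; set Q := dot u (K *m u); move: (K *m u) @Q => y Q uKK Ky hy uP.
rewrite dotDl !dotDr !dotNl !dotNr !dotZl !dotZr -/Q uKK Ky.
have : ab * (2 - ab * L) / P * dot u u <= ab * (2 - ab * L) * dot y y.
  rewrite mulrAC ler_pdivrMr// -[leRHS]mulrA (mulrC _ P) ler_wpM2l//.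
  by rewrite mulr_ge0// ltW.
(* With y = K u, y' K y <= (L + t) |y|^2, so the gain is at least a (2 - a L) |y|^2. *)
have : ab ^+ 2 * dot y (h *m y) <= ab ^+ 2 * (L * dot y y) by rewrite ler_wpM2l// sqr_ge0.
have : 0 <= ab ^+ 2 * t * dot y y by rewrite !mulr_ge0 ?sqr_ge0 ?dot_ge0// ltW.
rewrite /rho; lra.
Qed.

End gradient_map.

(** * Null stable sets of saddles, and the kernel of [A] *)

Section null_sets.
Variables (R : realType) (n : nat) (A B : 'M[R]_n).
Hypotheses (hA : psdmx A) (hB : pdmx B).
Local Notation V := ('cV[R]_n * R)%type.
Implicit Types (x y u v : 'cV[R]_n) (w : V).

Local Notation s := (anorm A).
Local Notation g := (grad A B).
Local Notation Phi := (gd_map A B).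

(* Two orbits staying near the saddle satisfy [q (k+1) >= rho^2 q k] for
   [q = Q dx - da^2], so [q 0 <= 0]: the stable set is a Lipschitz graph over a
   hyperplane transverse to a direction where [Q > 0]. *)
Lemma saddle_stable_null xb ab L : 0 < s xb -> g xb = 0 -> 0 < L -> 0 < ab < 2 / L ->
  (forall u, dot u (hess A B xb *m u) <= L * dot u u) ->
  (exists v, dot v (hess A B xb *m v) < 0) ->
  exists2 r, 0 < r & cube_null [set w | forall k, `|iter k Phi w - (xb, ab)| <= r].
Proof.
move=> sb gb L0 abL hL [v vneg].
have [K [rho2 [c [Ks vK rho1 c0 QJ]]]] := unstable_form hA hB L0 abL hL vneg.
pose J := gd_slope A B ab xb xb.
pose k := n%:R ^+ 2 * `|K|; have k0 : 0 <= k by rewrite !mulr_ge0.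
pose j := n%:R * `|J|; have j0 : 0 <= j by rewrite mulr_ge0.
pose N : R := n%:R + 1; have N1 : 1 <= N by rewrite lerDr.
pose C := 4 * k * j * N + 2 * k * N ^+ 2 + 1.
have C0 : 0 < C by rewrite ltr_wpDl// addr_ge0// !mulr_ge0 ?exprn_ge0// ?(le_trans ler01).
(* [C] collects the errors of replacing the slope by [J]. Then C e <= c absorbs those in |dx|^2, and
   C e <= rho2 - 1 those in da^2, which the map leaves unchanged. *)
pose e := Num.min 1 (Num.min (c / C) ((rho2 - 1) / C)).
have e0 : 0 < e by rewrite !lt_min ltr01 !divr_gt0// subr_gt0.
have e1 : e <= 1 by rewrite ge_min lexx.
have Cec : C * e <= c by rewrite mulrC -ler_pdivlMr// !ge_min lexx orbT.
have Cer : C * e <= rho2 - 1 by rewrite mulrC -ler_pdivlMr// !ge_min lexx !orbT.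
have [r r0 hr] := gd_slope_near B ab sb e0.
pose Q u := - dot u (K *m u).
pose q w w' := Q (w.1 - w'.1) - (w.2 - w'.2) ^+ 2.
have grow w w' : `|w - (xb, ab)| <= r -> `|w' - (xb, ab)| <= r ->
    rho2 * q w w' <= q (Phi w) (Phi w').
  move=> wr wr'; have [sw Jw gw] := hr _ _ wr wr'; have [sw' _ _] := hr _ _ wr' wr.
  rewrite gb subr0 -/J in gw Jw; rewrite /q /= gd_step_sub//.
  move: gw Jw; move: (g w'.1) => gy gw.
  move: (gd_slope A B w.2 w.1 w'.1) => G Jw.
  move: (w.1 - w'.1) (w.2 - w'.2) => dx da.
  pose E := (G - J) *m dx - da *: gy.
  have -> : G *m dx - da *: gy = J *m dx + E.
    by rewrite /E (mulmxBl G J) [RHS]addrA [J *m dx + _]addrC subrK.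
  set m := `|dx| + `|da|; have m0 : 0 <= m by rewrite addr_ge0.
  have Em : `|E| <= N * e * m.
    apply: (le_trans (ler_normB _ _)).
    have : `|(G - J) *m dx| <= n%:R * (e * `|dx|).
      by apply: (le_trans (norm_mulmx_le _ _)); rewrite ler_wpM2l// ler_wpM2r.
    have : `|da *: gy| <= `|da| * e by rewrite normrZ ler_wpM2l.
    have : 0 <= n%:R * (e * `|da|) by rewrite !mulr_ge0// ltW.
    have : 0 <= e * `|dx| by rewrite mulr_ge0// ltW.
    by rewrite /N /m; lra.
  have Jm : `|J *m dx| <= j * m.
    apply: (le_trans (norm_mulmx_le _ _)); rewrite /j -mulrA ler_wpM2l// ler_wpM2l//.
    by rewrite lerDl.
  have Ne0 : 0 <= N * e * m by rewrite !mulr_ge0 ?(ltW e0)// (le_trans ler01).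
  move: E Em => E Em.
  have QE : Q (J *m dx + E) = Q (J *m dx) - 2 * dot (J *m dx) (K *m E) - dot E (K *m E).
    rewrite /Q mulmxDr !dotDl !dotDr (dot_sym E (J *m dx) Ks); ring.
  have b1 : dot (J *m dx) (K *m E) <= k * ((j * m) * (N * e * m)).
    apply: (le_trans (ler_norm _)); apply: (le_trans (norm_bil_le _ _ _)).
    by rewrite ler_wpM2l// ler_pM.
  have b2 : dot E (K *m E) <= k * ((N * e * m) * (N * m)).
    apply: (le_trans (ler_norm _)); apply: (le_trans (norm_bil_le _ _ _)).
    rewrite ler_wpM2l// ler_pM//; apply: (le_trans Em).
    by rewrite mulrAC ler_piMr// mulr_ge0// (le_trans ler01).
  have b3 : 2 * (k * ((j * m) * (N * e * m))) + k * ((N * e * m) * (N * m)) <=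
      C * e / 2 * m ^+ 2.
    have : 0 <= e * m ^+ 2 by rewrite mulr_ge0 ?exprn_ge0// ltW.
    by rewrite /C; lra.
  have m2 : m ^+ 2 <= 2 * (dot dx dx + da ^+ 2).
    have := sqr_norm_le_dot dx; rewrite -[da ^+ 2]real_normK ?num_real// /m => h.
    have := sqr_ge0 (`|dx| - `|da|).
    by rewrite sqrrB sqrrD; lra.
  have b4 : C * e / 2 * m ^+ 2 <= C * e * (dot dx dx + da ^+ 2).
    have := ler_wpM2l (_ : 0 <= C * e / 2) m2; rewrite divr_ge0 ?mulr_ge0 ?(ltW C0) ?(ltW e0)//.
    by move=> /(_ isT); lra.
  have b5 : C * e * dot dx dx <= c * dot dx dx by rewrite ler_wpM2r// dot_ge0.
  have b6 : C * e * da ^+ 2 <= (rho2 - 1) * da ^+ 2 by rewrite ler_wpM2r// sqr_ge0.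
  have b7 := QJ dx; rewrite -/J in b7.
  by rewrite QE /Q; lra.
exists r => //.
pose W := [set w | forall k, `|iter k Phi w - (xb, ab)| <= r].
have Wq w w' : W w -> W w' -> q w w' <= 0.
  move=> Ww Ww'; rewrite leNgt; apply/negP => q0.
  pose t := rho2 - 1; have t0 : 0 < t by rewrite subr_gt0.
  (* Bernoulli's linear lower bound for the geometric growth already contradicts the bound [D] on
     the ball. *)
  have lin m : (1 + m%:R * t) * q w w' <= q (iter m Phi w) (iter m Phi w').
    elim: m => [|m IH]; first by rewrite mul0r addr0 mul1r.
    apply: le_trans (grow _ _ (Ww m) (Ww' m)).
    have : rho2 * ((1 + m%:R * t) * q w w') <= rho2 * q (iter m Phi w) (iter m Phi w').
      by rewrite ler_wpM2l// ltW// (lt_trans ltr01).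
    apply: le_trans; rewrite mulrA ler_wpM2r ?(ltW q0)// -natr1.
    have -> : rho2 = 1 + t by rewrite /t addrC subrK.
    have : 0 <= m%:R * t * t by rewrite !mulr_ge0// ltW.
    lra.
  pose D := k * (2 * r) ^+ 2.
  have qD m : q (iter m Phi w) (iter m Phi w') <= D.
    have dr : `|(iter m Phi w).1 - (iter m Phi w').1| <= 2 * r.
      apply: (le_trans (ler_norm_fst _ _)).
      rewrite -[X in `|X|](subrKA (xb, ab)) mulrDl mul1r.
      apply: (le_trans (ler_normD _ _)); apply: lerD; first exact: Ww.
      by rewrite distrC; exact: Ww'.
    rewrite /q; move: ((iter m Phi w).1 - _) dr => dx dr; rewrite lerBlDr /Q -dotNr.
    apply: (@le_trans _ _ D); last by rewrite lerDl sqr_ge0.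
    apply: (le_trans (ler_norm _)); rewrite dotNr normrN.
    apply: (le_trans (norm_bil_le _ _ _)); rewrite /D ler_wpM2l// expr2.
    by rewrite ler_pM.
  pose m := Num.truncn (D / (t * q w w')).
  have tq : 0 < t * q w w' by rewrite mulr_gt0.
  have := truncnS_gt (D / (t * q w w')); rewrite ltr_pdivrMr// -/m.
  have := le_trans (lin m.+1) (qD m.+1).
  move: q0; lra.
have [i vi] : exists i, v i 0 != 0.
  apply: contrapT => no; move: vK; suff -> : v = 0 by rewrite dot0l ltxx.
  apply/colP => i; rewrite mxE; apply/eqP; apply: contraT => vi.
  by exfalso; apply: no; exists i.
pose kap := - dot v (K *m v); have kap0 : 0 < kap by rewrite oppr_gt0.
have Qadd (a : R) y : Q (a *: v + y) = kap * a ^+ 2 - 2 * a * dot y (K *m v) - dot y (K *m y).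
  rewrite /Q mulmxDr -scalemxAr !dotDl !dotDr !dotZl !dotZr (dot_sym v y Ks) /kap; ring.
(* Nonpositivity of q gives kap tau^2 <= (1 + k) m^2 + 2 k |v| m |tau|, which fails as soon as |tau|
   > C1 m. *)
pose C1 := 1 + (1 + k + 2 * k * `|v|) / kap.
have kv0 : 0 <= 1 + k + 2 * k * `|v| by rewrite addr_ge0 ?mulr_ge0// addr_ge0.
have C11 : 1 <= C1 by rewrite lerDl divr_ge0// ltW.
apply: (@cube_null_graph_dir _ _ v i (C1 * `|v i 0|) _ vi) => w w' Ww Ww'.
set dx := w.1 - w'.1.
have := Wq _ _ Ww Ww'; rewrite /q -/dx.
set da := w.2 - w'.2; set tau := dx i 0 / v i 0; set p := dx - tau *: v.
set m := Num.max _ _ => qle.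
have m0 : 0 <= m by rewrite le_max normr_ge0.
have pm : `|p| <= m by rewrite le_max lexx.
have dam : `|da| <= m by rewrite le_max lexx orbT.
suff taum : `|tau| <= C1 * m.
  have -> : dx i 0 = tau * v i 0 by rewrite divfK.
  by rewrite normrM mulrAC ler_wpM2r.
have dxE : dx = tau *: v + p by rewrite addrC subrK.
have Qdx : Q dx = kap * tau ^+ 2 - 2 * tau * dot p (K *m v) - dot p (K *m p).
  by rewrite {1}dxE Qadd.
have b1 : 2 * tau * dot p (K *m v) <= 2 * `|tau| * (k * (m * `|v|)).
  apply: (le_trans (ler_norm _)); rewrite !normrM ger0_norm// ler_wpM2l ?mulr_ge0//.
  apply: (le_trans (norm_bil_le _ _ _)); rewrite ler_wpM2l// ler_wpM2r//.
have b2 : dot p (K *m p) <= k * (m * m).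
  apply: (le_trans (ler_norm _)); apply: (le_trans (norm_bil_le _ _ _)).
  by rewrite ler_wpM2l// ler_pM.
have b3 : da ^+ 2 <= m * m.
  by rewrite -[da ^+ 2]real_normK ?num_real// expr2 ler_pM.
have b4 : kap * `|tau| ^+ 2 <= (1 + k) * (m * m) + 2 * k * `|v| * (m * `|tau|).
  by rewrite real_normK ?num_real//; move: qle; rewrite Qdx; lra.
rewrite leNgt; apply/negP => taugt.
have mt : m <= `|tau| by apply: (le_trans _ (ltW taugt)); rewrite ler_peMl.
have tau0 : 0 < `|tau| by apply: le_lt_trans taugt; rewrite mulr_ge0// (le_trans ler01).
have b5 : m * m <= m * `|tau| by rewrite ler_wpM2l.
have b6 : kap * (C1 * m) * `|tau| < kap * `|tau| * `|tau|.
  by rewrite ltr_pM2r// ltr_pM2l.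
have b7 : kap * (C1 * m) * `|tau| = kap * m * `|tau| + (1 + k + 2 * k * `|v|) * (m * `|tau|).
  by rewrite /C1; field; rewrite gt_eqF.
have b8 : (1 + k) * (m * m) <= (1 + k) * (m * `|tau|) by rewrite ler_wpM2l// addr_ge0.
have b9 : 0 <= kap * m * `|tau| by rewrite !mulr_ge0// ltW.
move: b4; rewrite expr2; lra.
Qed.

(** If [A i j] is nonzero, row i of A x = 0 determines the j-th coordinate linearly from the others,
    so the kernel lies in a graph in that direction. *)
Lemma kernel_null : A != 0 -> cube_null [set w : V | A *m w.1 = 0].
Proof.
move=> A0; have [i [j Aij]] : exists i j, A i j != 0.
  apply: contrapT => no; move/eqP: A0; apply; apply/matrixP => i j; rewrite [RHS]mxE.
  by apply/eqP; apply: contraT => h; exfalso; apply: no; exists i, j.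
pose v : 'cV[R]_n := delta_mx j 0.
have vj : v j 0 = 1 by rewrite mxE !eqxx.
have vj0 : v j 0 != 0 by rewrite vj oner_eq0.
apply: (@cube_null_graph_dir _ _ v j (n%:R * `|A| / `|A i j|) _ vj0).
move=> w w' /= Aw Aw'; rewrite vj divr1; set dx := w.1 - w'.1.
have Adx : A *m dx = 0 by rewrite mulmxBr Aw Aw' subrr.
set p := dx - _; set m := Num.max _ _.
have pm : `|p| <= m by rewrite le_max lexx.
rewrite mulrAC ler_pdivlMr ?normr_gt0// -normrM.
have -> : dx j 0 * A i j = - (A *m p) i 0.
  by rewrite /p mulmxBr Adx sub0r -scalemxAr -colE !mxE opprK.
rewrite normrN; apply: (le_trans (ler_mx_norm_entry _ _ _)).
apply: (le_trans (norm_mulmx_le _ _)); rewrite mulrA ler_wpM2l// mulr_ge0//.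
Qed.

End null_sets.

Lemma loclip_uniform (R : realType) (X : normedModType R) (I : finType)
    (f : I -> X -> R) a : (forall i, loclip (f i) a) ->
  exists r C, [/\ 0 < r, 0 <= C & forall i u v,
    `|u - a| <= r -> `|v - a| <= r -> `|f i u - f i v| <= C * `|u - v|].
Proof.
move=> h.
suff [r [C [r0 C0 H]]] : exists r C, [/\ 0 < r, 0 <= C & forall i, i \in enum I ->
    forall u v, `|u - a| <= r -> `|v - a| <= r -> `|f i u - f i v| <= C * `|u - v|].
  by exists r, C; split => // i; apply: H; rewrite mem_enum.
elim: (enum I) => [|i s [r [C [r0 C0 H]]]]; first by exists 1, 0.
have [r' [C' [r'0 C'0 H']]] := h i.
exists (Num.min r r'), (C + C'); split; rewrite ?lt_min ?r0 ?addr_ge0//.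
move=> k ks u v; rewrite !le_min => /andP[ur ur'] /andP[vr vr']; rewrite mulrDl.
move: ks; rewrite inE => /orP[/eqP ->|ks].
  by apply: (le_trans (H' _ _ ur' vr')); rewrite lerDr mulr_ge0.
by apply: (le_trans (H _ ks _ _ ur vr)); rewrite lerDl mulr_ge0.
Qed.

(** * Points where the gradient map has a singular Jacobian *)

Section singular_set.
Variables (R : realType) (n : nat) (A B : 'M[R]_n).
Hypotheses (hA : psdmx A) (hB : pdmx B).
Local Notation V := ('cV[R]_n * R)%type.
Implicit Types (x y u v : 'cV[R]_n) (w : V).

Local Notation s := (anorm A).
Local Notation hess := (hess A B).

Definition singular : set V := [set w | 0 < w.2 /\ 0 < s w.1 /\
  gd_slope A B w.2 w.1 w.1 \notin unitmx].

Definition shifted_form w u : R := dot u (hess w.1 *m u) - w.2^-1 * dot u u.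

(** By Courant-Fischer: at least j eigenvalues of the Hessian exceed [w.2^-1]. The rows of [W] span
    the subspace, and positivity makes them independent. *)
Definition posdim j w := exists W : 'M[R]_(j, n), forall c : 'rV_j, c != 0 ->
  0 < shifted_form w (c *m W)^T.

Lemma posdim0 w : posdim 0 w.
Proof. by exists 0 => c; rewrite [c]thinmx0 eqxx. Qed.

Lemma posdim_le j w : posdim j w -> (j <= n)%N.
Proof.
move=> [W hW]; rewrite leqNgt; apply/negP => nj.
have : kermx W != 0.
  rewrite kermx_eq0 /row_free; apply/negP => /eqP rk.
  by have := rank_leq_col W; rewrite rk leqNgt nj.
case/rowV0Pn => c /sub_kermxP cW c0; have := hW _ c0.
by rewrite cW trmx0 /shifted_form !dot0l mulr0 subrr ltxx.
Qed.

Lemma singular_eigenvector w : singular w ->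
  exists2 u : 'cV[R]_n, u != 0 & hess w.1 *m u = w.2^-1 *: u.
Proof.
move=> [a0 [_ /negP sing]]; apply: contrapT => no; apply: sing.
apply: unitmx_inj => u; rewrite mulmxBl mul1mx -scalemxAl => /eqP.
rewrite subr_eq0 => /eqP uE; apply: contrapT => /eqP u0; apply: no.
by exists u => //; rewrite [in RHS]uE scalerA mulVf ?scale1r// gt_eqF.
Qed.

(** The eigenvector for [w.2^-1] is in the radical of the form at [w], so adding it to the positive
    subspace leaves the form nonnegative there. Passing to [w'] adds a positive multiple of
    |z|^2. *)
Lemma posdim_succ j w w' (e : R) : singular w -> posdim j w ->
  (forall u, dot u (hess w.1 *m u) <= dot u (hess w'.1 *m u) + e * dot u u) ->
  e < w.2^-1 - w'.2^-1 -> posdim j.+1 w'.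
Proof.
move=> sw [W hW] he te; have [u u0 hu] := singular_eigenvector sw.
exists (col_mx u^T W) => c c0.
have hs : (hess w.1)^T = hess w.1 := hess_tr hA hB _.
set c1 := @lsubmx R 1 1 j c; set c2 := @rsubmx R 1 1 j c.
have cE : c = row_mx c1 c2 by rewrite hsubmxK.
pose y := (c2 *m W)^T; pose z := c1 0 0 *: u + y.
have -> : (c *m col_mx u^T W)^T = z.
  have -> : c *m col_mx u^T W = c1 *m u^T + c2 *m W.
    have := @mul_row_col R 1 1 j n c1 c2 u^T W; rewrite -cE; exact.
  by apply/colP => k; rewrite /z /y !mxE big_ord1 !mxE.
have Fz : shifted_form w z = shifted_form w y.
  rewrite /shifted_form /z mulmxDr -scalemxAr hu.
  move: (c1 0 0) => a; clearbody y.
  rewrite !dotDl !dotDr !dotZl !dotZr (dot_sym u y hs) hu dotZr (dotC u y).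
  by ring.
have grow : shifted_form w z + (w.2^-1 - w'.2^-1 - e) * dot z z <= shifted_form w' z.
  by rewrite /shifted_form; have := he z; lra.
apply: lt_le_trans grow; rewrite Fz.
have d0 : 0 < w.2^-1 - w'.2^-1 - e by rewrite subr_gt0.
have [c20|c20] := eqVneq c2 0.
  have c10 : c1 0 0 != 0.
    apply: contra c0 => /eqP c10; rewrite cE c20 [c1]mx11_scalar c10.
    by rewrite (_ : 0%:M = 0) ?row_mx0//; apply/matrixP => ? ?; rewrite !mxE mul0rn.
  rewrite /z /y c20 mul0mx trmx0 addr0 /shifted_form !dot0l mulr0 subrr add0r.
  by rewrite mulr_gt0// dot_gt0// scaler_eq0 negb_or c10.
by rewrite ltr_wpDr ?hW// mulr_ge0 ?dot_ge0// ltW.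
Qed.

(* On a stratum of constant [posdim], [1 / w.2] is the same ordered eigenvalue of
   the Hessian, hence a Lipschitz function of the point (Weyl). *)
Lemma singular_null : cube_null singular.
Proof.
apply: (@cube_null_sub _ _ _ (\bigcup_j
    [set w | singular w /\ posdim j w /\ ~ posdim j.+1 w])).
  move=> w sw; apply: contrapT => no.
  have all j : posdim j w.
    elim: j => [|j IH]; first exact: posdim0.
    by apply: contrapT => nj; apply: no; exists j.
  by have := posdim_le (all n.+1); rewrite ltnn.
apply: cube_null_bigcup => j; apply: cube_null_local => wb [[ab0 [sb _]] _].
have lid (p q : 'cV[R]_n) : `|p - q| <= 1 * `|p - q| by rewrite mul1r.
have [|r [C [r0 C0 hC]]] := @loclip_uniform R _ ('I_n * 'I_n)%type
    (fun ij x => hess x ij.1 ij.2) wb.1.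
  move=> [k l] /=; under eq_fun do rewrite hess_entry.
  apply: loclip_add; first exact: loclip_cst.
  by apply: loclip_opp; apply: (loclip_psi_slope _ _ lid lid).
pose K := n%:R ^+ 2 * C; pose M := wb.2 + r.
exists r => //; apply: (@cube_null_graph _ _ (M ^+ 2 * K)).
have form x y : `|x - wb.1| <= r -> `|y - wb.1| <= r -> forall u,
    dot u (hess x *m u) <= dot u (hess y *m u) + K * `|x - y| * dot u u.
  move=> xr yr u; rewrite addrC -lerBlDr.
  have -> : dot u (hess x *m u) - dot u (hess y *m u) = dot u ((hess x - hess y) *m u).
    by rewrite (mulmxBl (hess x)) dotDr dotNr.
  apply: (le_trans (ler_norm _)); apply: (le_trans (norm_quad_le _ _)).
  rewrite ler_wpM2r ?dot_ge0// /K -mulrA ler_wpM2l//.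
  apply/mx_norm_leP; first by rewrite mulr_ge0.
  move=> k l; have -> (P Q : 'M[R]_n) : (P - Q) k l = P k l - Q k l by rewrite !mxE.
  exact: (hC (k, l)).
have le w w' : singular w /\ posdim j w /\ ~ posdim j.+1 w ->
    singular w' /\ posdim j w' /\ ~ posdim j.+1 w' ->
    `|w - wb| <= r -> `|w' - wb| <= r -> w.2^-1 - w'.2^-1 <= K * `|w.1 - w'.1|.
  move=> [sw [pw _]] [_ [_ npw']] /pair_norm_leP[w1 _] /pair_norm_leP[w1' _].
  rewrite leNgt; apply/negP => lt; apply: npw'.
  by apply: posdim_succ sw pw _ lt; exact: form.
move=> w w' [zw /= wr] [zw' /= wr'].
have := le _ _ zw zw' wr wr'; have := le _ _ zw' zw wr' wr.
rewrite (distrC w'.1).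
move: zw zw' => [[a0 _] _] [[b0 _] _].
have aM : w.2 <= M.
  by have := (pair_norm_leP _ _).1 wr => -[_]; rewrite ler_norml /M => /andP[_]; lra.
have bM : w'.2 <= M.
  by have := (pair_norm_leP _ _).1 wr' => -[_]; rewrite ler_norml /M => /andP[_]; lra.
move: w.2 w'.2 a0 b0 aM bM => a b a0 b0 aM bM h1 h2.
(* Both stepsizes are at most [M], so the estimate on inverses transfers to the stepsizes. *)
have -> : a - b = a * b * (b^-1 - a^-1) by field; rewrite !gt_eqF.
rewrite normrM -mulrA ler_pM//.
  by rewrite ger0_norm ?mulr_ge0 ?(ltW a0) ?(ltW b0)// expr2 ler_pM// ltW.
by rewrite ler_norml; apply/andP; split; lra.
Qed.

End singular_set.

(** * The exceptional set and convergence outside it *)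

Section exceptional_set.
Variables (R : realType) (n : nat) (A B : 'M[R]_n).
Hypotheses (hA : psdmx A) (hB : pdmx B) (hA0 : A != 0).
Local Notation V := ('cV[R]_n * R)%type.
Implicit Types w : V.
Local Notation s := (anorm A).
Local Notation Phi := (gd_map A B).

Definition stable_in q : set V := [set w | forall k, rat_cube q (iter k Phi w)].

(** Rational cubes replace the possibly uncountable family of saddle neighbourhoods by a countable
    one; only cubes with a null stable set enter. *)
Definition exceptional0 : set V := [set w | A *m w.1 = 0] `|` singular A B `|`
  \bigcup_(q in [set q | cube_null (stable_in q)]) stable_in q.

(** Preimages are taken through regular points only, where the local inverse applies. Other points
    of positive stepsize lie in [exceptional0] already, so the complement of the union is forward
    invariant there. *)
Fixpoint exceptional k : set V :=
  if k is k'.+1 then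
    [set w | [/\ 0 < s w.1, gd_slope A B w.2 w.1 w.1 \in unitmx & exceptional k' (Phi w)]]
  else exceptional0.

Lemma exceptional_null k : cube_null (exceptional k).
Proof.
elim: k => [|k IH] /=.
  apply: cube_nullU.
    by apply: cube_nullU; [exact: kernel_null|exact: singular_null].
  apply: (@cube_null_sub _ _ _ (\bigcup_q
    if `[< cube_null (stable_in q) >] then stable_in q else set0)).
    by move=> w [q /= nq wq]; exists q => //; rewrite asboolT.
  apply: cube_null_bigcup_count => q.
  by case: asboolP => // _; exact: cube_null_set0.
apply: cube_null_local => -[xb ab] [/= sb Ju _].
have [r [C [r0 hC]]] := gd_map_local_inverse hA sb Ju.
exists r => //; apply: (@cube_null_pullback _ _ C _ Phi).
  by move=> w w' [_ wr] [_ wr']; exact: hC.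
by apply: cube_null_sub IH => _ [w [[_ _ ew] _] <-].
Qed.

Lemma exceptional_step w : 0 < w.2 -> ~ (\bigcup_k exceptional k) w ->
  A *m w.1 != 0 /\ ~ (\bigcup_k exceptional k) (Phi w).
Proof.
move=> a0 ew; have Aw : A *m w.1 != 0.
  by apply/eqP => Aw; apply: ew; exists 0%N => //; left; left.
split => // -[k _ ek]; apply: ew.
have sw : 0 < s w.1 by rewrite anorm_gt0.
have [Ju|Ju] := boolP (gd_slope A B w.2 w.1 w.1 \in unitmx); first by exists k.+1.
by exists 0%N => //; left; right.
Qed.

Variable L : R.
Hypotheses (hL : 0 < L) (hHess : forall x : 'cV[R]_n, A *m x != 0 ->
  loewner_le (hessian (objective A B) x) L%:M).

Lemma nonexceptional_cvg (x0 : 'cV[R]_n) alpha : 0 < alpha < 2 / L ->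
  ~ (\bigcup_k exceptional k) (x0, alpha) ->
  let x := gradient_descent (objective A B) alpha x0 in
  (forall k, A *m x k != 0) /\
  exists2 xstar : 'cV[R]_n, x k @[k --> \oo] --> xstar &
    forall y, objective A B xstar <= objective A B y.
Proof.
move=> al ex x; have [a0 _] := andP al.
have iter2 k : (iter k Phi (x0, alpha)).2 = alpha by elim: k.
have exk k : ~ (\bigcup_k exceptional k) (iter k Phi (x0, alpha)).
  by elim: k => // k IH; have [] := exceptional_step _ IH; rewrite ?iter2.
have Ak k : A *m (iter k Phi (x0, alpha)).1 != 0.
  by have [] := exceptional_step _ (exk k); rewrite ?iter2.
have iter1 k : (iter k Phi (x0, alpha)).1 = x k.
  elim: k => // k IH; have := Ak k; rewrite iterS /= iter2 IH => Axk.
  by rewrite /gd_step -(gradientE hA hB Axk).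
have iterE k : iter k Phi (x0, alpha) = (x k, alpha).
  by rewrite [LHS]surjective_pairing iter1 iter2.
have Ax k : A *m x k != 0 by rewrite -iter1.
split => //.
have xS k : x k.+1 = gd_step A B alpha (x k).
  by rewrite -iter1 iterS iterE.
have sx k : 0 < s (x k) by rewrite anorm_gt0.
have [l [xl sl gl]] := orbit_cvg_critical hA hB hA0 hL hHess al xS sx.
exists l => //; have [//|saddle] := critical_min_or_saddle hA hB sl gl.
exfalso; have Al : A *m l != 0 by rewrite -anorm_gt0.
have [r r0 Nr] := saddle_stable_null hA hB sl gl hL al
  (fun u => hess_le hA hB hHess u Al) saddle.
(* This cube lies in the ball where the stable set is null, and its centre is within half its radius
   of the saddle. The tail of the orbit uses the other half and stays in the cube, so the iterate
   number N is exceptional. *)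
have [q [lq qr]] := rat_cube_dense (l, alpha) r0.
have nq : cube_null (stable_in q).
  by apply: cube_null_sub Nr => w wq k; exact/qr/wq.
have q0 : 0 < q.2.+1%:R^-1 / 2 :> R by rewrite divr_gt0 ?invr_gt0.
move/cvgrPdist_le : xl => /(_ _ q0)[N _ hN].
apply: (exk N); exists 0%N => //; right; exists q => //= k.
rewrite -iterD iterE /rat_cube /=.
have := hN (k + N)%N (leq_addl _ _); rewrite /= distrC => xk.
rewrite -(subrKA (l, alpha)); apply: (le_trans (ler_normD _ _)).
rewrite [leRHS](splitr (q.2.+1%:R^-1)); apply: lerD => //.
apply/pair_norm_leP; split => //=.
by rewrite subrr normr0 ltW.
Qed.

End exceptional_set.

Theorem theorem3p5 (R : realType) (n : nat) (A B : 'M[R]_n) (L : R)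
    (hA : psdmx A) (hA0 : A != 0) (hB : pdmx B) (hL : 0 < L)
    (hHess : forall x : 'cV[R]_n, A *m x != 0 ->
       loewner_le (hessian (objective A B) x) L%:M) :
  {ae (lebesgue_tuple R n \x lebesgue_measure)%E,
    forall z : n.-tuple (measurableTypeR R) * measurableTypeR R,
    let x0 : 'cV[R]_n := col_of_tuple z.1 in
    let alpha : R := z.2 in
    let x := gradient_descent (objective A B) alpha x0 in
    0 < alpha < 2 / L ->
    (forall k, A *m x k != 0) /\
    exists2 xstar : 'cV[R]_n,
      x k @[k --> \oo] --> xstar &
      forall y : 'cV[R]_n, objective A B xstar <= objective A B y}.
Proof.
have null := cube_null_negligible (cube_null_bigcup (exceptional_null hA hB hA0)).
apply: negligibleS null => z /= bad; apply: contrapT => ex; apply: bad => al.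
exact: (nonexceptional_cvg hA hB hA0 hL hHess al ex).
Qed.
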